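(* A Maaß form $f\in\mathcal{S}(r,\mathcal{O}_{\mathbb{K}})$ belongs to $\mathcal{M}(r,\mathcal{O}_{\mathbb{K}})$ if and only if $f\in[\Delta_{2,\mathbb{K}}^*,r]$.
   Context: Let $\mathbb{K}=\mathbb{Q}(\sqrt{-m})$, $m$ squarefree, with discriminant $d_{\mathbb{K}}$ and ring of integers $\mathcal{O}_{\mathbb{K}}$; $\mathcal{O}_{\mathbb{K}}^{\star}=\frac{1}{\sqrt{d_{\mathbb{K}}}}\mathcal{O}_{\mathbb{K}}$. Let $\Lambda(2,\mathcal{O}_{\mathbb{K}})$ be the set of Hermitian $T=\begin{pmatrix}k&t\\\overline{t}&l\end{pmatrix}\in\mathbb{K}^{2\times2}$ with $k,l\in\mathbb{Z}$, $t\in\mathcal{O}_{\mathbb{K}}^{\star}$, and for $T\ne0$ let $\epsilon(T)=\max\{q\in\mathbb{N}:\frac1qT\in\Lambda(2,\mathcal{O}_{\mathbb{K}})\}$. Every $f\in[\Gamma_2(\mathcal{O}_{\mathbb{K}}),r]$ (Hermitian modular forms of degree 2 and weight $r$) has Fourier expansion $f(Z)=\sum_{T\ge0}\alpha_f(T)e^{2\pi i\,\mathrm{tr}(TZ)}$, $T\in\Lambda(2,\mathcal{O}_{\mathbb{K}})$. Sugano's Maaß space $\mathcal{S}(r,\mathcal{O}_{\mathbb{K}})$ consists of those $f$ with $\alpha_f(T)=\sum_{\eta\mid\epsilon(T)}\eta^{r-1}\alpha_f\begin{pmatrix}1&t/\eta\\\overline{t}/\eta&lk/\eta^2\end{pmatrix}$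 for all $T\ge0$, $T\ne0$. Krieg's Maaß space $\mathcal{M}(r,\mathcal{O}_{\mathbb{K}})$ consists of those $f$ for which there is $\alpha_f^*:\mathbb{N}_0\to\mathbb{C}$ with $\alpha_f(T)=\sum_{\eta\mid\epsilon(T)}\eta^{r-1}\alpha_f^*(-d_{\mathbb{K}}\det(T)/\eta^2)$ for all $T\ge0$, $T\ne0$. $[\Delta_{2,\mathbb{K}}^*,r]$ denotes modular forms of weight $r$ for the maximal discrete extension $\Delta_{2,\mathbb{K}}^*$ of $\Gamma_2(\mathcal{O}_{\mathbb{K}})$ in $SU(2,2;\mathbb{C})$, which equals $\bigcup_{d\mid d_{\mathbb{K}},\,d\text{ squarefree}}\Gamma_2(\mathcal{O}_{\mathbb{K}})W_d$ with $W_d=\mathrm{diag}(V_d,\overline{V_d}^{-tr})$ and Atkin–Lehner involutions $V_d=\frac{1}{\sqrt d}\begin{pmatrix}\alpha d&\beta(m+\sqrt{-m})\\\gamma(m-\sqrt{-m})&\delta d\end{pmatrix}\in SL_2(\mathbb{C})$. *)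

(* Defs.v *)
From HB Require Import structures.
From mathcomp Require Import all_boot all_order all_algebra.
From mathcomp Require Import all_classical all_reals all_analysis.
From mathcomp Require Import complex.

Set Implicit Arguments.
Unset Strict Implicit.
Unset Printing Implicit Defensive.

Import Order.TTheory GRing.Theory Num.Theory.
Import numFieldNormedType.Exports.

Local Open Scope classical_set_scope.
Local Open Scope ring_scope.

(* R[i] seen as a numClosedFieldType: this equips it with the topology of a
   normed space over itself, so that differentiability below is complex. *)
Definition Cplx (R : realType) : numClosedFieldType := R[i].

Definition cexp (R : realType) (z : Cplx R) : Cplx R :=
  Complex (expR (complex.Re z) * cos (complex.Im z))
          (expR (complex.Re z) * sin (complex.Im z)).

(* Unordered summation over D; for complex-valued u this is absolute
   convergence with sum s. *)
Definition has_sum (R : realType) (I : choiceType) (D : set I)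
    (u : I -> Cplx R) (s : Cplx R) : Prop :=
  forall e : Cplx R, 0 < e ->
    exists2 A0 : set I, fsets D A0 &
      forall A : set I, fsets D A -> A0 `<=` A ->
        `| s - \sum_(t \in A) u t | < e.

Definition squarefree (n : nat) : Prop :=
  forall k : nat, (k ^ 2 %| n)%N -> k = 1%N.

Definition mx2 (R : realType) (a b c d : Cplx R) : 'M[Cplx R]_2 :=
  \matrix_(i, j) (if i == 0 then (if j == 0 then a else b)
                  else (if j == 0 then c else d)).

Definition adjmx (R : realType) p q (A : 'M[Cplx R]_(p, q)) :
  'M[Cplx R]_(q, p) := map_mx Num.conj A^T.

(* In the order of Cplx R, 0 <= z and 0 < z entail that z is real; hence both
   predicates below force A to be Hermitian. *)
Definition posdefmx (R : realType) n (A : 'M[Cplx R]_n) : Prop :=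
  forall v : 'cV[Cplx R]_n, v != 0 -> 0 < (adjmx v *m A *m v) 0 0.

Definition possemidefmx (R : realType) n (A : 'M[Cplx R]_n) : Prop :=
  forall v : 'cV[Cplx R]_n, 0 <= (adjmx v *m A *m v) 0 0.

Definition sqrt_neg (R : realType) (m : nat) : Cplx R := sqrtC (- m%:R).

(* Discriminant of Q(sqrt(-m)), m squarefree. *)
Definition disc (m : nat) : int :=
  if (m %% 4)%N == 3%N then - m%:Z else - (4 * m)%:Z.

Definition quadK (R : realType) (m : nat) : set (Cplx R) :=
  [set z | exists x y : rat, z = ratr x + ratr y * sqrt_neg R m].

Definition ringO (R : realType) (m : nat) : set (Cplx R) :=
  [set z | quadK m z /\ integralOver (intr : int -> Cplx R) z].

Definition dualO (R : realType) (m : nat) : set (Cplx R) :=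
  [set t | exists2 s, ringO m s & t = (sqrtC (disc m)%:~R)^-1 * s].

Definition Lambda2 (R : realType) (m : nat) : set 'M[Cplx R]_2 :=
  [set T | exists k l : int, exists2 t : Cplx R, dualO m t &
     T = mx2 k%:~R t t^* l%:~R].

Definition Lambda2_ge0 (R : realType) (m : nat) : set 'M[Cplx R]_2 :=
  [set T | Lambda2 m T /\ possemidefmx T].

Definition content_cand (R : realType) (m : nat) (T : 'M[Cplx R]_2) : set nat :=
  [set q | (0 < q)%N /\ Lambda2 m (q%:R^-1 *: T)].

(* The junk value 0 is never taken when T is a nonzero element of Lambda2. *)
Definition content (R : realType) (m : nat) (T : 'M[Cplx R]_2) : nat :=
  xget 0%N [set q | content_cand m T q /\
                    forall q', content_cand m T q' -> (q' <= q)%N].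

Definition Jmx (R : realType) : 'M[Cplx R]_(2 + 2) :=
  block_mx 0 (- 1%:M) 1%:M 0.

Definition SU22 (R : realType) : set 'M[Cplx R]_(2 + 2) :=
  [set M | adjmx M *m Jmx R *m M = Jmx R /\ \det M = 1].

Definition Gamma2 (R : realType) (m : nat) : set 'M[Cplx R]_(2 + 2) :=
  [set M | SU22 M /\ forall i j, ringO m (M i j)].

(* All matrices V_d; any two of them differ by a factor in SL_2 of the ring of
   integers, so Gamma2 W_d below does not depend on the choice. *)
Definition AtkinLehner (R : realType) (m d : nat) : set 'M[Cplx R]_2 :=
  [set V | \det V = 1 /\
     exists a b c e : int,
       V = (sqrtC d%:R)^-1 *:
           mx2 (a%:~R * d%:R)                     (b%:~R * (m%:R + sqrt_neg R m))
               (c%:~R * (m%:R - sqrt_neg R m))    (e%:~R * d%:R)].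

Definition Wmx (R : realType) (V : 'M[Cplx R]_2) : 'M[Cplx R]_(2 + 2) :=
  block_mx V 0 0 (invmx (adjmx V)).

(* The maximal discrete extension of Gamma2 in SU(2,2), given as the union of
   the cosets Gamma2 W_d over the squarefree divisors d of the discriminant. *)
Definition DeltaStar (R : realType) (m : nat) : set 'M[Cplx R]_(2 + 2) :=
  [set M | exists d : nat, squarefree d /\ (d %| `|disc m|)%N /\
     exists2 G, Gamma2 m G & exists2 V, AtkinLehner m d V & M = G *m Wmx V].

Definition halfspace (R : realType) : set 'M[Cplx R]_2 :=
  [set Z | posdefmx ((2 * 'i)^-1 *: (Z - adjmx Z))].

Definition autfactor (R : realType) (M : 'M[Cplx R]_(2 + 2))
    (Z : 'M[Cplx R]_2) : 'M[Cplx R]_2 :=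
  dlsubmx M *m Z + drsubmx M.

Definition moebius (R : realType) (M : 'M[Cplx R]_(2 + 2))
    (Z : 'M[Cplx R]_2) : 'M[Cplx R]_2 :=
  (ulsubmx M *m Z + ursubmx M) *m invmx (autfactor M Z).

(* Forms are total functions, of which only the values on the half-space
   matter. *)
Definition modular_form (R : realType) (G : set 'M[Cplx R]_(2 + 2)) (r : int)
    (f : 'M[Cplx R]_2 -> Cplx R) : Prop :=
  (forall Z, halfspace Z -> differentiable f Z) /\
  (forall M Z, G M -> halfspace Z ->
     f (moebius M Z) = (\det (autfactor M Z)) ^ r * f Z).

(* alpha is the family of Fourier coefficients of f; only its values on
   Lambda2_ge0 matter, and these are determined by f. *)
Definition fourier_expansion (R : realType) (m : nat)
    (f alpha : 'M[Cplx R]_2 -> Cplx R) : Prop :=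
  forall Z, halfspace Z ->
    has_sum (@Lambda2_ge0 R m)
      (fun T => alpha T *
                cexp (2 * Complex pi 0 * 'i * \tr (T *m Z)))
      (f Z).

Definition sugano_space (R : realType) (m : nat) (r : int) :
    set ('M[Cplx R]_2 -> Cplx R) :=
  [set f | modular_form (@Gamma2 R m) r f /\
     exists2 alpha, fourier_expansion m f alpha &
       forall T, Lambda2_ge0 m T -> T != 0 ->
         alpha T = \sum_(eta <- divisors (content m T))
           eta%:R ^ (r - 1) *
           alpha (mx2 1                  (T 0 1 / eta%:R)
                      (T 1 0 / eta%:R)   (T 1 1 * T 0 0 / eta%:R ^+ 2))].

(* The argument of alphas is a nonnegative integer as soon as eta divides
   content m T; Num.truncn only casts it to nat. *)
Definition krieg_space (R : realType) (m : nat) (r : int) :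
    set ('M[Cplx R]_2 -> Cplx R) :=
  [set f | modular_form (@Gamma2 R m) r f /\
     exists2 alpha, fourier_expansion m f alpha &
       exists alphas : nat -> Cplx R,
       forall T, Lambda2_ge0 m T -> T != 0 ->
         alpha T = \sum_(eta <- divisors (content m T))
           eta%:R ^ (r - 1) *
           alphas (Num.truncn
             (complex.Re (- (disc m)%:~R * \det T / eta%:R ^+ 2)))].

(* Main.v *)
(* For V of determinant 1, f(V Z V* ) is the translate of f by diag(V, V^-* ), and
   its T-th Fourier coefficient is that of f at V'* T V' with V' = V^-1.  The
   matrices V_d preserve the lattice Lambda(2, O), the content and the
   determinant of T, so a form in Krieg's space, whose coefficients depend on
   content and determinant only, is invariant under all W_d.

   Conversely, Sugano's relations reduce everything to matrices with upper left
   entry 1, which have content 1.  Two such matrices with equal determinant have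
   off-diagonal entries s/sqrt(D), s'/sqrt(D) with N(s) = N(s') mod D.  For every
   prime p dividing D this forces s and s' to agree up to sign (up to swapping
   coordinates for p = 2, m = 1 mod 4) modulo the p-part of sqrt(D), and V_d changes
   the sign exactly at the primes dividing d.  Taking for d the product of the
   primes where s and s' disagree, V_d followed by a unipotent element of
   SL_2(O) carries one matrix to the other, so the two coefficients agree. *)

Require Import Defs.
From mathcomp Require Import all_boot all_order all_algebra.
From mathcomp Require Import all_classical all_reals all_analysis.
From mathcomp Require Import complex ring lra zify.

Set Implicit Arguments.
Unset Strict Implicit.
Unset Printing Implicit Defensive.

Import Order.TTheory GRing.Theory Num.Theory.

Local Open Scope classical_set_scope.
Local Open Scope ring_scope.

(** * Unordered sums *)

(** Both spaces only assert that some family [alpha] expands [f], so turning invariance of [f] into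
    relations between coefficients requires uniqueness of the expansion. It is obtained without
    integrating over a period: averages over finitely many Hermitian translates of Z, with suitable
    phases, kill any prescribed finite set of terms, and absolute convergence controls the others.
    The parameters of V_d come from a gcd and from Bezout. A squarefree m dividing a product P Q
    splits as g d with g dividing P and d dividing Q; this replaces a choice of sign at each prime.
    The Bezout relation that gives V_d determinant 1 also dictates the congruences through which V_d
    acts on s. One obstacle remains: V_d need not preserve the upper left entry 1. It does preserve
    the content, which is 1, so Sugano's relation at the image has a single term and restores the
    entry 1 with the same off-diagonal entry and the same determinant. Only then does the unipotent
    matrix finish the job. *)

Lemma has_sum_seqP (R : realType) (I : choiceType) (D : set I)
    (u : I -> Cplx R) (s : Cplx R) :
  has_sum D u s <->
  forall e : Cplx R, 0 < e -> exists2 l0 : seq I, [set` l0] `<=` D &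
    forall l, uniq l -> [set` l] `<=` D -> {subset l0 <= l} ->
      `| s - \sum_(t <- l) u t | < e.
Proof.
split=> h e e0; have [l0 l0D hl0] := h _ e0.
  have [/finite_seqP[k k0] kD] := l0D; exists k; first by rewrite -k0.
  move=> l ul lD kl; rewrite fsbig_seq //; apply: hl0; last by rewrite k0.
  by split => //; apply/finite_seqP; exists l.
exists [set` l0]; first by split => //; apply/finite_seqP; exists l0.
move=> A [/finite_seqP[l lA] AD] l0A; rewrite lA.
have -> : [set` l] = [set` undup l] by apply/seteqP; split => x /=; rewrite mem_undup.
rewrite -fsbig_seq ?undup_uniq //; apply: hl0; rewrite ?undup_uniq //.
  by move=> x /=; rewrite mem_undup => xl; apply: AD; rewrite lA.
by move=> x xl0; rewrite mem_undup; have := l0A x xl0; rewrite lA.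
Qed.

Lemma has_sumD (R : realType) (I : choiceType) (D : set I)
    (u v : I -> Cplx R) (s t : Cplx R) :
  has_sum D u s -> has_sum D v t -> has_sum D (fun i => u i + v i) (s + t).
Proof.
move=> /has_sum_seqP hu /has_sum_seqP hv; apply/has_sum_seqP => e e0.
have e20 : 0 < e / 2 by rewrite divr_gt0.
have [k kD hk] := hu _ e20; have [l lD hl] := hv _ e20.
exists (k ++ l) => [x /=|n un nD sub].
  by rewrite mem_cat => /orP[/kD|/lD].
rewrite big_split opprD addrACA (le_lt_trans (ler_normD _ _)) // [e]splitr ltrD //.
  by apply: hk => // x xk; apply: sub; rewrite mem_cat xk.
by apply: hl => // x xl; apply: sub; rewrite mem_cat xl orbT.
Qed.

Lemma has_sumZ (R : realType) (I : choiceType) (D : set I)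
    (u : I -> Cplx R) (s a : Cplx R) :
  has_sum D u s -> has_sum D (fun i => a * u i) (a * s).
Proof.
move=> /has_sum_seqP hu; apply/has_sum_seqP => e e0.
have a1 : 0 < `|a| + 1 by rewrite ltr_wpDl.
have [l lD hl] := hu _ (divr_gt0 e0 a1).
exists l => // n un nD sub; rewrite -mulr_sumr -mulrBr normrM.
have := hl n un nD sub; rewrite ltr_pdivlMr // mulrC; apply: le_lt_trans.
by rewrite ler_wpM2r // lerDl.
Qed.

Lemma eq_has_sum (R : realType) (I : choiceType) (D : set I)
    (u v : I -> Cplx R) (s : Cplx R) :
  (forall i, D i -> u i = v i) -> has_sum D u s -> has_sum D v s.
Proof.
move=> uv /has_sum_seqP hu; apply/has_sum_seqP => e e0.
have [l lD hl] := hu _ e0; exists l => // n un nD sub.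
rewrite (eq_big_seq u) ?hl // => x xn; apply/esym/uv; exact: nD.
Qed.

Lemma has_sum_reindex (R : realType) (I : choiceType) (D : set I)
    (g h : I -> I) (u : I -> Cplx R) (s : Cplx R) :
  cancel g h -> cancel h g ->
  (forall i, D i -> D (g i)) -> (forall i, D i -> D (h i)) ->
  has_sum D u s -> has_sum D (u \o g) s.
Proof.
move=> gK hK gD hD /has_sum_seqP hu; apply/has_sum_seqP => e e0.
have [l lD hl] := hu _ e0; exists (map h l) => [x /= /mapP[y /lD yD ->]|n un nD sub].
  exact: hD.
have -> : \sum_(t <- n) (u \o g) t = \sum_(t <- map g n) u t by rewrite big_map.
apply: hl.
- by rewrite map_inj_uniq //; apply: can_inj gK.
- by move=> x /= /mapP[y /nD yD ->]; apply: gD.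
- by move=> x xl; apply/mapP; exists (h x); rewrite ?hK // sub // map_f.
Qed.

(** Cauchy's criterion: the sum over [l0] and the sum over [l0] with [l] adjoined are both within e
    / 2 of s. *)
Lemma has_sum_tail (R : realType) (I : choiceType) (D : set I)
    (u : I -> Cplx R) (s : Cplx R) :
  has_sum D u s -> forall e : Cplx R, 0 < e ->
  exists l0 : seq I, forall l, uniq l -> [set` l] `<=` D ->
    {in l, forall x, x \notin l0} -> `| \sum_(t <- l) u t | < e.
Proof.
move=> /has_sum_seqP hu e e0.
have e20 : 0 < e / 2 by rewrite divr_gt0.
have [l0 l0D hl] := hu _ e20; exists (undup l0) => l ul lD dis.
have h1 : `|s - \sum_(t <- undup l0) u t| < e / 2.
  apply: hl; rewrite ?undup_uniq // => x; rewrite ?mem_undup //=.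
  by rewrite mem_undup; apply: l0D.
have h2 : `|s - \sum_(t <- undup l0 ++ l) u t| < e / 2.
  apply: hl.
  - rewrite cat_uniq undup_uniq ul andbT; apply/hasPn => x xl; exact: dis.
  - by move=> x /=; rewrite mem_cat mem_undup => /orP[/l0D|/lD].
  - by move=> x xl; rewrite mem_cat mem_undup xl.
rewrite big_cat /= in h2.
set a := \sum_(t <- undup l0) _ in h1 h2; set b := \sum_(t <- l) _ in h2 *.
have -> : b = (s - a) - (s - (a + b)) by ring.
by rewrite (le_lt_trans (ler_normB _ _)) // [e]splitr ltrD.
Qed.

(** The nonnegative and the negative terms form two sub-sums, each bounded by e. This is where
    control of all sub-sums becomes absolute convergence. *)
Lemma sumr_norm_split (R : realType) (I : eqType) (l : seq I) (x : I -> R) (e : R) :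
  (forall P : pred I, `| \sum_(t <- l | P t) x t | < e) ->
  \sum_(t <- l) `|x t| < e + e.
Proof.
move=> h; rewrite (bigID (fun t => 0 <= x t)) /= ltrD //.
  rewrite (eq_bigr x); last by move=> i /ger0_norm.
  by rewrite (le_lt_trans (ler_norm _)).
rewrite (eq_bigr (fun t => - x t)); last by move=> i; rewrite -ltNge => /ltr0_norm.
by rewrite sumrN (le_lt_trans (ler_norm _)) // normrN.
Qed.

Lemma Re_sum (R : realType) (I : Type) (l : seq I) (P : pred I) (u : I -> Cplx R) :
  complex.Re (\sum_(t <- l | P t) u t) = \sum_(t <- l | P t) complex.Re (u t).
Proof. by elim/big_rec2: _ => //= i x y _ <-; case: (u i); case: y. Qed.

Lemma Im_sum (R : realType) (I : Type) (l : seq I) (P : pred I) (u : I -> Cplx R) :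
  complex.Im (\sum_(t <- l | P t) u t) = \sum_(t <- l | P t) complex.Im (u t).
Proof. by elim/big_rec2: _ => //= i x y _ <-; case: (u i); case: y. Qed.

Lemma ler_norm_ReIm (R : realType) (z : Cplx R) :
  `|z| <= Complex (`|complex.Re z| + `|complex.Im z|) 0.
Proof.
case: z => a b; rewrite [X in X <= _]normc_def /= lecR.
rewrite -[leRHS]ger0_norm ?addr_ge0 // -sqrtr_sqr ler_sqrt ?sqr_ge0 //.
by rewrite sqrrD !real_normK ?num_real // lerD2r lerDl mulrn_wge0 ?mulr_ge0.
Qed.

Lemma ltr_ReIm_norm (R : realType) (z : Cplx R) (e : R) :
  `|z| < Complex e 0 -> `|complex.Re z| < e /\ `|complex.Im z| < e.
Proof.
case: z => a b; rewrite [X in X < _]normc_def /= ltcR => h.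
by split; apply: le_lt_trans h; rewrite -sqrtr_sqr ler_wsqrtr // ?lerDl ?lerDr sqr_ge0.
Qed.

Lemma has_sum_abs_tail (R : realType) (I : choiceType) (D : set I)
    (u : I -> Cplx R) (s : Cplx R) :
  has_sum D u s -> forall e : Cplx R, 0 < e ->
  exists l0 : seq I, forall l, uniq l -> [set` l] `<=` D ->
    {in l, forall x, x \notin l0} -> \sum_(t <- l) `|u t| < e.
Proof.
move=> hu [e ei]; rewrite ltcE /= => /andP[/eqP -> e0].
(* Four pieces: the positive and negative parts of the real and of the imaginary parts. *)
have e40 : 0 < Complex (e / 4) 0 :> Cplx R by rewrite ltcR divr_gt0.
have [l0 hl0] := has_sum_tail hu e40; exists l0 => l ul lD dis.
have hP P : `|\sum_(t <- l | P t) u t| < Complex (e / 4) 0.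
  rewrite -big_filter; apply: hl0; rewrite ?filter_uniq // => x.
    by rewrite /= mem_filter => /andP[_ /lD].
  by rewrite mem_filter => /andP[_ /dis].
have hre : \sum_(t <- l) `|complex.Re (u t)| < e / 4 + e / 4.
  by apply: sumr_norm_split => P; have [] := ltr_ReIm_norm (hP P); rewrite Re_sum.
have him : \sum_(t <- l) `|complex.Im (u t)| < e / 4 + e / 4.
  by apply: sumr_norm_split => P; have [] := ltr_ReIm_norm (hP P); rewrite Im_sum.
apply: (@le_lt_trans _ _
  (\sum_(t <- l) Complex (`|complex.Re (u t)| + `|complex.Im (u t)|) 0)).
  by apply: ler_sum => t _; apply: ler_norm_ReIm.
rewrite -(rmorph_sum (real_complex R)) ltcR big_split /=.
have -> : e = (e / 4 + e / 4) + (e / 4 + e / 4) by field.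
exact: ltrD.
Qed.

(** * Uniqueness of Fourier coefficients *)

Lemma imaginaryE (R : realType) : 'i = Complex 0 1 :> Cplx R.
Proof. by []. Qed.

Lemma cexpD (R : realType) (x y : Cplx R) : cexp (x + y) = cexp x * cexp y.
Proof.
case: x => a b; case: y => c d; rewrite /cexp /=.
rewrite expRD cosD sinD; apply/eqP; rewrite eq_complex /=.
by apply/andP; split; apply/eqP; ring.
Qed.

Lemma cexp0 (R : realType) : cexp 0 = 1 :> Cplx R.
Proof. by rewrite /cexp /= expR0 cos0 sin0 mulr1 mulr0. Qed.

Definition eexp (R : realType) (x : Cplx R) : Cplx R :=
  cexp (2 * Complex pi 0 * 'i * x).

Lemma eexpD (R : realType) (x y : Cplx R) : eexp (x + y) = eexp x * eexp y.
Proof. by rewrite /eexp mulrDr cexpD. Qed.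

Lemma eexp0 (R : realType) : eexp 0 = 1 :> Cplx R.
Proof. by rewrite /eexp mulr0 cexp0. Qed.

Lemma eexp_neq0 (R : realType) (x : Cplx R) : eexp x != 0.
Proof.
apply/eqP => h; have := @eexp0 R; rewrite -(subrr x) eexpD h mul0r.
by move/eqP; rewrite eq_sym oner_eq0.
Qed.

Lemma eexp_arg (R : realType) (a : R) :
  2 * Complex pi 0 * 'i * Complex a 0 = Complex 0 (2 * pi * a) :> Cplx R.
Proof.
rewrite imaginaryE; apply/eqP; rewrite eq_complex /=.
by apply/andP; split; apply/eqP => /=; ring.
Qed.

Lemma norm_eexp_real (R : realType) (x : Cplx R) : x \is Num.real -> `|eexp x| = 1.
Proof.
move=> /complex_realP[a ->]; rewrite /eexp eexp_arg /cexp /= expR0 !mul1r.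
by rewrite [LHS]normc_def /= cos2Dsin2 sqrtr1.
Qed.

Lemma eexp_half (R : realType) : eexp 2^-1 = -1 :> Cplx R.
Proof.
have -> : 2^-1 = Complex 2^-1 0 :> Cplx R.
  by rewrite -[RHS]/(real_complex R 2^-1) fmorphV rmorph_nat.
rewrite /eexp eexp_arg /cexp /= expR0 !mul1r.
have -> : 2 * pi * 2^-1 = pi :> R by field.
by rewrite cospi sinpi; apply/eqP; rewrite eq_complex /= oppr0 !eqxx.
Qed.

(** * Conjugate transposes and the half-space *)

Lemma adjmxM (R : realType) p q n (A : 'M[Cplx R]_(p, q)) (B : 'M[Cplx R]_(q, n)) :
  adjmx (A *m B) = adjmx B *m adjmx A.
Proof. by rewrite /adjmx trmx_mul map_mxM. Qed.

Lemma adjmxK (R : realType) p q (A : 'M[Cplx R]_(p, q)) : adjmx (adjmx A) = A.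
Proof. by apply/matrixP => i j; rewrite !mxE conjCK. Qed.

Lemma adjmxD (R : realType) p q (A B : 'M[Cplx R]_(p, q)) :
  adjmx (A + B) = adjmx A + adjmx B.
Proof. by apply/matrixP => i j; rewrite !mxE rmorphD. Qed.

Lemma adjmxB (R : realType) p q (A B : 'M[Cplx R]_(p, q)) :
  adjmx (A - B) = adjmx A - adjmx B.
Proof. by apply/matrixP => i j; rewrite !mxE rmorphB. Qed.

Lemma adjmxZ (R : realType) p q (a : Cplx R) (A : 'M[Cplx R]_(p, q)) :
  adjmx (a *: A) = a^* *: adjmx A.
Proof. by apply/matrixP => i j; rewrite !mxE rmorphM. Qed.

Lemma adjmx1 (R : realType) n : adjmx 1%:M = 1%:M :> 'M[Cplx R]_n.
Proof. by rewrite /adjmx trmx1 map_mx1. Qed.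

Lemma det_adjmx (R : realType) n (A : 'M[Cplx R]_n) : \det (adjmx A) = (\det A)^*.
Proof. by rewrite /adjmx det_map_mx det_tr. Qed.

Lemma mxtrace_adjmx (R : realType) n (A : 'M[Cplx R]_n) : \tr (adjmx A) = (\tr A)^*.
Proof. by rewrite /mxtrace rmorph_sum; apply: eq_bigr => i _; rewrite !mxE. Qed.

Lemma mxtrace_herm_real (R : realType) n (A B : 'M[Cplx R]_n) :
  adjmx A = A -> adjmx B = B -> \tr (A *m B) \is Num.real.
Proof.
by move=> hA hB; apply/CrealP; rewrite -mxtrace_adjmx adjmxM hA hB mxtrace_mulC.
Qed.

Lemma mxtrace_herm_sq (R : realType) n (A : 'M[Cplx R]_n) :
  adjmx A = A -> A != 0 -> 0 < \tr (A *m A).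
Proof.
move=> hA; rewrite -{3}hA => A0.
have trE : \tr (A *m adjmx A) = \sum_i \sum_j `|A i j| ^+ 2.
  apply: eq_bigr => i _; rewrite !mxE; apply: eq_bigr => j _.
  by rewrite !mxE normCK.
have [i [j Aij]] : exists i j, A i j != 0.
  apply/not_existsP => h; move/eqP: A0; apply; apply/matrixP => i j; rewrite mxE.
  by apply/eqP/negPn/negP => hij; apply: (h i); exists j.
rewrite trE (bigD1 i) //= ltr_wpDr //.
  by apply: sumr_ge0 => k _; apply: sumr_ge0 => l _; rewrite exprn_ge0.
rewrite (bigD1 j) //= ltr_wpDr ?exprn_gt0 ?normr_gt0 //.
by apply: sumr_ge0 => k _; rewrite exprn_ge0.
Qed.

Lemma halfspaceD (R : realType) (Z X : 'M[Cplx R]_2) :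
  halfspace Z -> adjmx X = X -> halfspace (Z + X).
Proof.
move=> hZ hX; rewrite /halfspace /= adjmxD hX opprD addrACA subrr addr0.
exact: hZ.
Qed.

Lemma halfspace_i (R : realType) : halfspace ('i%:M : 'M[Cplx R]_2).
Proof.
rewrite /halfspace /= -scalemx1 adjmxZ adjmx1 conjCi scaleNr opprK -scalerDl scalerA.
rewrite -(mulr2n 'i) -(mulr_natl 'i) mulVf ?mulf_neq0 ?pnatr_eq0 ?neq0Ci // scale1r.
move=> v v0; rewrite mulmx1.
have [i vi] : exists i, v i 0 != 0.
  apply/not_existsP => h; move/eqP: v0; apply; apply/matrixP => i j.
  by rewrite mxE ord1; apply/eqP/negPn/negP => hij; apply: (h i).
rewrite mxE (bigD1 i) //= ltr_wpDr //.
  by apply: sumr_ge0 => k _; rewrite !mxE mulrC -normCK exprn_ge0.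
by rewrite !mxE mulrC -normCK exprn_gt0 ?normr_gt0.
Qed.

Section FourierUniqueness.
Variables (R : realType) (D : set 'M[Cplx R]_2) (beta : 'M[Cplx R]_2 -> Cplx R).
Hypothesis D_herm : forall T, D T -> adjmx T = T.
Hypothesis beta0 : forall Z, halfspace Z ->
  has_sum D (fun T => beta T * eexp (\tr (T *m Z))) 0.

(* The operator g(Z) -> (g(Z) + e(- tr(T0 X)) g(Z + X)) / 2 multiplies the
   T-th term by (1 + e(tr((T - T0) X))) / 2, which is 1 at T0; for
   X = (T1 - T0) / (2 tr((T1 - T0)^2)) it kills the T1-th term. *)
Lemma annihilating_weights (T0 : 'M[Cplx R]_2) (l : seq 'M[Cplx R]_2) :
  D T0 -> [set` l] `<=` D -> T0 \notin l ->
  exists w : 'M[Cplx R]_2 -> Cplx R,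
    [/\ forall T, D T -> `|w T| <= 1, w T0 = 1, forall T, T \in l -> w T = 0 &
     forall Z, halfspace Z ->
       has_sum D (fun T => w T * (beta T * eexp (\tr (T *m Z)))) 0].
Proof.
move=> DT0; elim: l => [|T1 l IH] lD.
  move=> _; exists (fun=> 1); split => [T _|//|//|Z hZ]; first by rewrite normr1.
  by apply: eq_has_sum (beta0 hZ) => T _; rewrite mul1r.
rewrite inE negb_or => /andP[T01 T0l].
have [|//|w [w1 wT0 wl hw]] := IH; first by move=> x xl; apply: lD; rewrite /= inE xl orbT.
have DT1 : D T1 by apply: lD; rewrite /= inE eqxx.
pose E := T1 - T0; pose X := (2 * \tr (E *m E))^-1 *: E.
have hE : adjmx E = E by rewrite adjmxB !D_herm.
have E0 : E != 0 by rewrite subr_eq0 eq_sym.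
have trE := mxtrace_herm_sq hE E0.
have hX : adjmx X = X.
  rewrite adjmxZ hE; congr (_ *: _); apply: conj_Creal.
  by rewrite realV realM ?realn ?(gtr0_real trE).
exists (fun T => w T * ((1 + eexp (\tr ((T - T0) *m X))) / 2)); split.
- move=> T DT; rewrite normrM mulr_ile1 ?w1 // normrM normfV [`|2|]normr_nat.
  rewrite ler_pdivrMr // mul1r (le_trans (ler_normD _ _)) // normr1 norm_eexp_real //.
  by apply: mxtrace_herm_real; rewrite // adjmxB !D_herm.
- by rewrite subrr mul0mx mxtrace0 eexp0 wT0 mul1r divff ?pnatr_eq0.
- move=> T; rewrite inE => /orP[/eqP->|/wl ->]; last by rewrite mul0r.
  rewrite -/E -scalemxAr mxtraceZ.
  have -> : (2 * \tr (E *m E))^-1 * \tr (E *m E) = 2^-1.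
    by field; rewrite (gt_eqF trE).
  by rewrite eexp_half subrr mul0r mulr0.
- move=> Z hZ.
  have h1 := has_sumZ 2^-1 (hw _ hZ).
  have h2 := has_sumZ (2^-1 * eexp (- \tr (T0 *m X))) (hw _ (halfspaceD hZ hX)).
  have := has_sumD h1 h2; rewrite !mulr0 addr0; apply: eq_has_sum => T DT.
  rewrite mulmxDr mxtraceD eexpD mulmxBl mxtraceD eexpD raddfN /=.
  set a := eexp (- _); set b := eexp (\tr (T *m X)); by field.
Qed.

(** At Z = i, the terms outside a finite [l0] have total modulus below |u T0| / 2. Weights of
    modulus at most 1 kill the rest of [l0] and keep the T0-term. A large partial sum of the
    weighted series is then u T0 plus less than |u T0| / 2, yet it is itself below |u T0| / 2. *)
Lemma fourier_coef_eq0 (T0 : 'M[Cplx R]_2) : D T0 -> beta T0 = 0.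
Proof.
move=> DT0; apply/eqP; apply: contraT => b0.
pose Z : 'M[Cplx R]_2 := 'i%:M.
have hZ : halfspace Z := @halfspace_i R.
pose u T := beta T * eexp (\tr (T *m Z)).
have u0 : 0 < `|u T0| / 2 by rewrite divr_gt0 // normr_gt0 mulf_neq0 ?eexp_neq0.
have [l0 hl0] := has_sum_abs_tail (beta0 hZ) u0.
pose l1 := undup [seq T <- l0 | `[< D T >] && (T != T0)].
have l1D : [set` l1] `<=` D.
  by move=> T /=; rewrite mem_undup mem_filter => /andP[/andP[/asboolP]].
have T0l1 : T0 \notin l1 by rewrite mem_undup mem_filter eqxx andbF.
have [w [w1 wT0 wl hw]] := annihilating_weights DT0 l1D T0l1.
have [l2 l2D hl2] := (has_sum_seqP _ _ _).1 (hw Z hZ) _ u0.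
(* The remaining indices of [l2]: the list [T0 :: l1] followed by [l3] contains [l2], while [l3]
   avoids [l0]. *)
pose l3 := undup [seq T <- l2 | T \notin T0 :: l1].
have l3D : [set` l3] `<=` D.
  by move=> T /=; rewrite mem_undup mem_filter => /andP[_ /l2D].
have l3P T : T \in l3 -> T \notin T0 :: l1.
  by rewrite mem_undup mem_filter => /andP[].
have := hl2 ((T0 :: l1) ++ l3).
have ul : uniq ((T0 :: l1) ++ l3).
  rewrite cat_uniq [uniq (_ :: _)]/= T0l1 !undup_uniq /= andbT.
  by apply/hasPn => T /l3P.
have lD : [set` (T0 :: l1) ++ l3] `<=` D.
  move=> T /=; rewrite !inE mem_cat => /orP[/eqP -> //|/orP[/l1D//|/l3D//]].
have sub : {subset l2 <= (T0 :: l1) ++ l3}.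
  move=> T Tl2; rewrite mem_cat; case: (boolP (T \in _)) => //= Tn.
  by rewrite mem_undup mem_filter Tn.
move=> /(_ ul lD sub); rewrite sub0r normrN big_cat big_cons /=.
rewrite [X in _ + X + _]big1_seq => [|T /andP[_ /wl ->]]; last by rewrite mul0r.
rewrite wT0 mul1r addr0 -/(u T0) => h.
have h3 : `|\sum_(T <- l3) w T * u T| < `|u T0| / 2.
  have : \sum_(T <- l3) `|u T| < `|u T0| / 2.
    apply: hl0 => //; first exact: undup_uniq.
    move=> T Tl3; have := l3P _ Tl3; rewrite inE negb_or => /andP[TT0].
    rewrite mem_undup mem_filter TT0 andbT; apply: contra => ->; rewrite andbT.
    by apply/asboolP/l3D.
  apply: le_lt_trans; apply: (le_trans (ler_norm_sum _ _ _)).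
  rewrite !big_seq; apply: ler_sum => T /l3D DT.
  by rewrite normrM ler_piMl // w1.
have := ltrD h h3; rewrite -splitr => h4.
have := le_lt_trans (ler_normB _ _) h4.
by rewrite /u addrK ltxx.
Qed.

End FourierUniqueness.

(** * Translates of a form *)

Lemma has_sum_unique (R : realType) (I : choiceType) (D : set I)
    (u : I -> Cplx R) (s t : Cplx R) : has_sum D u s -> has_sum D u t -> s = t.
Proof.
move=> hs /(has_sumZ (-1)) ht; apply/eqP; rewrite -subr_eq0; apply: contraT => st.
have [|l lD hl] := (has_sum_seqP _ _ _).1 (has_sumD hs ht) `|s - t|.
  by rewrite normr_gt0.
have := hl (undup l); rewrite big1 => [|i _]; last by rewrite mulN1r subrr.
rewrite undup_uniq mulN1r subr0 ltxx => h; apply: h => // x /=; rewrite mem_undup //.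
exact: lD.
Qed.

(** * Two-by-two matrices *)

Lemma matrix2P (K : Type) (A B : 'M[K]_2) :
  A 0 0 = B 0 0 -> A 0 1 = B 0 1 -> A 1 0 = B 1 0 -> A 1 1 = B 1 1 -> A = B.
Proof.
have two i : i = 0 \/ i = 1 :> 'I_2.
  by case: i => [[|[|//]] ?]; [left|right]; apply: val_inj.
move=> h00 h01 h10 h11; apply/matrixP => i j.
by case: (two i) => ->; case: (two j) => ->.
Qed.

Section Mx2.
Variable R : realType.
Implicit Types a b c d : Cplx R.

Lemma mx2_00 a b c d : mx2 a b c d 0 0 = a. Proof. by rewrite mxE. Qed.
Lemma mx2_01 a b c d : mx2 a b c d 0 1 = b. Proof. by rewrite mxE. Qed.
Lemma mx2_10 a b c d : mx2 a b c d 1 0 = c. Proof. by rewrite mxE. Qed.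
Lemma mx2_11 a b c d : mx2 a b c d 1 1 = d. Proof. by rewrite mxE. Qed.
Definition mx2E := (mx2_00, mx2_01, mx2_10, mx2_11).

Lemma mx2_eta (A : 'M[Cplx R]_2) : A = mx2 (A 0 0) (A 0 1) (A 1 0) (A 1 1).
Proof. by apply: matrix2P; rewrite mx2E. Qed.

Lemma mulmx2E (A B : 'M[Cplx R]_2) i j : (A *m B) i j = A i 0 * B 0 j + A i 1 * B 1 j.
Proof.
by rewrite mxE big_ord_recl big_ord1; congr (_ + A i _ * B _ j); apply: val_inj.
Qed.

Lemma mul_mx2 a b c d a' b' c' d' :
  mx2 a b c d *m mx2 a' b' c' d' =
  mx2 (a * a' + b * c') (a * b' + b * d') (c * a' + d * c') (c * b' + d * d').
Proof. by apply: matrix2P; rewrite mulmx2E !mx2E. Qed.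

Lemma adjmx_mx2 a b c d : adjmx (mx2 a b c d) = mx2 a^* c^* b^* d^*.
Proof. by apply: matrix2P; rewrite !mxE. Qed.

Lemma scale_mx2 x a b c d : x *: mx2 a b c d = mx2 (x * a) (x * b) (x * c) (x * d).
Proof. by apply: matrix2P; rewrite !mxE. Qed.

Lemma det_mx2 a b c d : \det (mx2 a b c d) = a * d - b * c.
Proof.
rewrite (expand_det_row _ 0) big_ord_recl big_ord1 /cofactor !det_mx11 !mxE /=.
by rewrite expr0 expr1; ring.
Qed.

Lemma one_mx2 : 1%:M = mx2 1 0 0 1 :> 'M[Cplx R]_2.
Proof. by apply: matrix2P; rewrite !mxE. Qed.

Lemma mx2_1_unit a b c d : a * d - b * c = 1 ->
  mx2 a b c d *m mx2 d (- b) (- c) a = 1%:M.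
Proof.
by move=> h; rewrite mul_mx2 one_mx2 -h; congr mx2; ring.
Qed.

End Mx2.

Section Translates.
Variables (R : realType) (V : 'M[Cplx R]_2).
Hypothesis detV : \det V = 1.

Let V_unit : V \in unitmx. Proof. by rewrite unitmxE detV unitr1. Qed.

Let adjV_unit : adjmx V \in unitmx.
Proof. by rewrite unitmxE det_adjmx detV conjC1 unitr1. Qed.

Lemma det_invmx_adj : \det (invmx (adjmx V)) = 1.
Proof. by rewrite det_inv det_adjmx detV conjC1 invr1. Qed.

Lemma halfspace_conj Z : halfspace Z -> halfspace (V *m Z *m adjmx V).
Proof.
move=> hZ v v0; have := hZ (adjmx V *m v).
have -> : V *m Z *m adjmx V - adjmx (V *m Z *m adjmx V) =
    V *m (Z - adjmx Z) *m adjmx V.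
  by rewrite !adjmxM adjmxK mulmxBr mulmxBl !mulmxA.
rewrite adjmxM adjmxK -!(scalemxAr, scalemxAl) !mulmxA; apply.
by apply: contra v0 => /eqP h; rewrite -(mulKmx adjV_unit v) h mulmx0.
Qed.

(** Cocycle relation: W_V contributes the factor [invmx (adjmx V)], whose determinant is 1, so the
    weight does not see V. *)
Lemma autfactor_mulW G Z :
  autfactor (G *m Wmx V) Z = autfactor G (V *m Z *m adjmx V) *m invmx (adjmx V).
Proof.
rewrite /autfactor -[G in LHS]submxK /Wmx mulmx_block block_mxKdl block_mxKdr.
rewrite !mulmx0 addr0 add0r mulmxDl !mulmxA -[X in X + _ = _]mulmx1.
by rewrite -(mulmxV adjV_unit) !mulmxA.
Qed.

Lemma moebius_mulW G Z : autfactor G (V *m Z *m adjmx V) \in unitmx ->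
  moebius (G *m Wmx V) Z = moebius G (V *m Z *m adjmx V).
Proof.
move=> Gu; rewrite /moebius autfactor_mulW.
set B := invmx (adjmx V); have Bu : B \in unitmx by rewrite unitmx_inv.
set Q := autfactor G _ in Gu *.
have -> : invmx (Q *m B) = invmx B *m invmx Q.
  have QBu : Q *m B \in unitmx by rewrite unitmx_mul Gu.
  by rewrite -[RHS](mulKmx QBu) -mulmxA (mulKVmx Bu) mulmxV // mulmx1.
rewrite -[G in ulsubmx (G *m _)]submxK -[G in ursubmx (G *m _)]submxK /Wmx mulmx_block.
rewrite block_mxKul block_mxKur !mulmx0 addr0 add0r -/B invmxK [LHS]mulmxA; congr (_ *m _).
by rewrite mulmxDl -!mulmxA /B mulVmx // mulmx1.
Qed.

End Translates.

Lemma adjmx_Jmx (R : realType) (P Q : 'M[Cplx R]_2) :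
  adjmx (col_mx P Q) *m Jmx R *m col_mx P Q = adjmx Q *m P - adjmx P *m Q.
Proof.
rewrite /adjmx tr_col_mx map_row_mx /Jmx mul_row_block mul_row_col.
by rewrite !mulmx0 add0r addr0 mulmxN !mulmx1 mulNmx.
Qed.

(** If the factor Q kills a vector v, the identity [key] makes the form of Z - [adjmx Z] vanish at
    v, against positivity. The identity is invariance of J under M, evaluated on the column with
    blocks Z and 1. *)
Lemma autfactor_unit (R : realType) (M : 'M[Cplx R]_(2 + 2)) (Z : 'M[Cplx R]_2) :
  adjmx M *m Jmx R *m M = Jmx R -> halfspace Z -> autfactor M Z \in unitmx.
Proof.
move=> hM hZ; rewrite -unitmx_tr unitmxE unitfE; apply/det0P => -[v v0 hv].
pose P := ulsubmx M *m Z + ursubmx M; pose Q := autfactor M Z.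
have MZ : M *m col_mx Z 1%:M = col_mx P Q.
  by rewrite -[M in LHS]submxK mul_block_col !mulmx1.
have key : Z - adjmx Z = adjmx Q *m P - adjmx P *m Q.
  rewrite -adjmx_Jmx -MZ; set X := col_mx Z _.
  have -> : adjmx (M *m X) *m Jmx R *m (M *m X) =
      adjmx X *m (adjmx M *m Jmx R *m M) *m X.
    by rewrite adjmxM !mulmxA.
  by rewrite hM adjmx_Jmx adjmx1 mul1mx mulmx1.
have Qv : Q *m v^T = 0 by apply: trmx_inj; rewrite trmx_mul trmxK hv trmx0.
have := hZ v^T; rewrite -(inj_eq trmx_inj) trmxK trmx0 => /(_ v0).
rewrite key -scalemxAr -scalemxAl mulmxBr mulmxBl !mulmxA -adjmxM Qv.
rewrite -[_ *m adjmx P *m Q *m _]mulmxA Qv mulmx0 subr0.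
by rewrite /adjmx trmx0 map_mx0 !mul0mx scaler0 mxE ltxx.
Qed.

Lemma autfactor1 (R : realType) (Z : 'M[Cplx R]_2) : autfactor 1%:M Z = 1%:M.
Proof.
by rewrite /autfactor (@scalar_mx_block _ 2 2 1) block_mxKdl block_mxKdr mul0mx add0r.
Qed.

Lemma moebius1 (R : realType) (Z : 'M[Cplx R]_2) : moebius 1%:M Z = Z.
Proof.
rewrite /moebius autfactor1 (@scalar_mx_block _ 2 2 1) block_mxKul block_mxKur.
by rewrite mul1mx addr0 invmx1 mulmx1.
Qed.

Lemma modular_form_Wmx (R : realType) (S : set 'M[Cplx R]_(2 + 2)) r f V Z :
  modular_form S r f -> S (Wmx V) -> \det V = 1 -> halfspace Z ->
  f (V *m Z *m adjmx V) = f Z.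
Proof.
move=> [_ hf] SV detV hZ.
have := hf _ _ SV hZ; rewrite -[Wmx V]mul1mx autfactor_mulW // moebius_mulW //.
  by rewrite autfactor1 moebius1 mul1mx det_invmx_adj // exp1rz mul1r.
by rewrite autfactor1 unitmx1.
Qed.

Section FourierTranslates.
Variables (R : realType) (m : nat) (f alpha : 'M[Cplx R]_2 -> Cplx R).
Hypothesis hfa : fourier_expansion m f alpha.
Variables V V' : 'M[Cplx R]_2.
Hypotheses (VV' : V *m V' = 1%:M) (V'V : V' *m V = 1%:M).
Hypothesis VL : forall T, Lambda2 m T -> Lambda2 m (adjmx V *m T *m V).
Hypothesis V'L : forall T, Lambda2 m T -> Lambda2 m (adjmx V' *m T *m V').

Lemma possemidefmx_conj (U T : 'M[Cplx R]_2) :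
  possemidefmx T -> possemidefmx (adjmx U *m T *m U).
Proof. by move=> hT v; have := hT (U *m v); rewrite adjmxM !mulmxA. Qed.

Lemma conj_cancel (U U' : 'M[Cplx R]_2) : U *m U' = 1%:M ->
  cancel (fun T => adjmx U *m T *m U) (fun T => adjmx U' *m T *m U').
Proof.
move=> h T; rewrite !mulmxA -adjmxM h adjmx1 mul1mx -mulmxA h mulmx1 //.
Qed.

(** With ^H for [adjmx], the trace of T V Z V^H is that of V^H T V Z; reindexing by T -> V'^H T V'
    moves V from the argument to the coefficients. *)
Lemma has_sum_translate Z : halfspace (V *m Z *m adjmx V) ->
  has_sum (@Lambda2_ge0 R m)
    (fun T => alpha (adjmx V' *m T *m V') * eexp (\tr (T *m Z)))
    (f (V *m Z *m adjmx V)).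
Proof.
move=> hZ.
have L T : Lambda2_ge0 m T -> Lambda2_ge0 m (adjmx V *m T *m V).
  by case=> /VL hT /(possemidefmx_conj V).
have L' T : Lambda2_ge0 m T -> Lambda2_ge0 m (adjmx V' *m T *m V').
  by case=> /V'L hT /(possemidefmx_conj V').
have := has_sum_reindex (conj_cancel V'V) (conj_cancel VV') L' L (hfa hZ).
apply: eq_has_sum => T _ /=; congr (_ * eexp _).
rewrite mulmxA mxtrace_mulC !mulmxA -adjmxM V'V adjmx1 mul1mx -!mulmxA.
by rewrite [V' *m _]mulmxA V'V mul1mx.
Qed.

End FourierTranslates.

Lemma Lambda2_herm (R : realType) m (T : 'M[Cplx R]_2) : Lambda2 m T -> adjmx T = T.
Proof.
by move=> [k [l [t _ ->]]]; rewrite adjmx_mx2 conjCK !rmorph_int.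
Qed.

(** The expansions of f(Z) and of f(V Z V^H) have the same sum, so the difference [beta] of their
    coefficients vanishes by uniqueness. *)
Lemma fourier_coef_conj (R : realType) (m : nat) (f alpha : 'M[Cplx R]_2 -> Cplx R) V V' :
  fourier_expansion m f alpha -> \det V = 1 ->
  V *m V' = 1%:M -> V' *m V = 1%:M ->
  (forall T, Lambda2 m T -> Lambda2 m (adjmx V *m T *m V)) ->
  (forall T, Lambda2 m T -> Lambda2 m (adjmx V' *m T *m V')) ->
  (forall Z, halfspace Z -> f (V *m Z *m adjmx V) = f Z) ->
  forall T, Lambda2_ge0 m T -> alpha (adjmx V *m T *m V) = alpha T.
Proof.
move=> hfa detV VV' V'V VL V'L hfV T [LT pT].
have LVT : Lambda2_ge0 m (adjmx V *m T *m V).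
  by split; [apply: VL|apply: possemidefmx_conj].
pose beta T := alpha T - alpha (adjmx V' *m T *m V').
suff : beta (adjmx V *m T *m V) = 0.
  by rewrite /beta (conj_cancel VV') => /eqP; rewrite subr_eq0 => /eqP.
apply: (@fourier_coef_eq0 _ (@Lambda2_ge0 R m)) LVT => [U [+ _]|Z hZ].
  exact: Lambda2_herm.
have h1 := hfa _ hZ.
have h2 := has_sum_translate hfa VV' V'V VL V'L (halfspace_conj detV hZ).
rewrite hfV // in h2.
have := has_sumD h1 (has_sumZ (-1) h2); rewrite mulN1r subrr.
by apply: eq_has_sum => U _; rewrite /beta mulrBl mulN1r.
Qed.

Lemma fourier_conj_invariant (R : realType) (m : nat)
    (f alpha : 'M[Cplx R]_2 -> Cplx R) V V' :
  fourier_expansion m f alpha -> \det V = 1 ->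
  V *m V' = 1%:M -> V' *m V = 1%:M ->
  (forall T, Lambda2 m T -> Lambda2 m (adjmx V *m T *m V)) ->
  (forall T, Lambda2 m T -> Lambda2 m (adjmx V' *m T *m V')) ->
  (forall T, Lambda2_ge0 m T -> alpha (adjmx V' *m T *m V') = alpha T) ->
  forall Z, halfspace Z -> f (V *m Z *m adjmx V) = f Z.
Proof.
move=> hfa detV VV' V'V VL V'L ha Z hZ.
apply: has_sum_unique (hfa _ hZ).
apply: eq_has_sum (has_sum_translate hfa VV' V'V VL V'L (halfspace_conj detV hZ)).
by move=> T LT; rewrite ha.
Qed.

(** * Arithmetic of Atkin-Lehner parameters *)

Lemma squarefree_gt0 m : squarefree m -> (0 < m)%N.
Proof. by case: m => // /(_ 2); rewrite dvdn0 => /(_ isT). Qed.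

Lemma squarefree_dvd m d : squarefree m -> (d %| m)%N -> squarefree d.
Proof. by move=> hm dm k kd; apply: hm; apply: dvdn_trans dm. Qed.

(** With g = gcd(m, P), the cofactor m / g is prime to P / g and so divides Q; squarefreeness makes
    it prime to g. *)
Lemma squarefree_split (m : nat) (P Q : int) : squarefree m -> (m %| P * Q)%Z ->
  exists g d : nat, [/\ m = (g * d)%N, coprime g d, (g %| P)%Z & (d %| Q)%Z].
Proof.
move=> hm; have m0 := squarefree_gt0 hm.
rewrite dvdzE abszM absz_nat => mPQ.
set g := gcdn m `|P|%N.
have g0 : (0 < g)%N by rewrite gcdn_gt0 m0.
have mE : m = (g * (m %/ g))%N by rewrite mulnC divnK // dvdn_gcdl.
have PE : `|P|%N = (g * (`|P| %/ g))%N by rewrite mulnC divnK // dvdn_gcdr.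
have cop : coprime (m %/ g) (`|P| %/ g).
  rewrite /coprime -(eqn_pmul2l g0) muln1 muln_gcdr -mE -PE //.
exists g, (m %/ g)%N; split => //.
- rewrite /coprime; apply/eqP/hm.
  by rewrite {2}mE expnS expn1 dvdn_mul ?dvdn_gcdl ?dvdn_gcdr.
- by rewrite dvdzE dvdn_gcdr.
- rewrite dvdzE absz_nat -(Gauss_dvdr _ cop) -(dvdn_pmul2l g0) -mE mulnA -PE //.
Qed.

Lemma AtkinLehner_coefs (d k : nat) : coprime d k ->
  exists n e : int, d%:Z * e - n * k%:Z = 1.
Proof.
move=> dk; have [u [v]] := Bezoutz d k.
rewrite /gcdz !absz_nat (eqP dk) => h.
by exists (- v), u; apply: etrans h; ring.
Qed.

Lemma dvdz_coprime (g d : nat) (x : int) : coprime g d ->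
  (g %| x)%Z -> (d %| x)%Z -> ((g * d)%N %| x)%Z.
Proof. by rewrite !dvdzE !absz_nat => gd gx dx; rewrite Gauss_dvd // gx. Qed.

(** Split m = g d with g dividing x1 - x2 and d dividing x1 + x2. The Bezout relation d e - n g (m +
    1) = 1, multiplied by d, is the determinant condition on V_d. Modulo d, where m + 1 is 1, it
    says that h = g n is -1. Hence 1 + 2 h is 1 modulo g and -1 modulo d. *)
Lemma AtkinLehner_odd_disc (m : nat) (x1 x2 : int) : squarefree m ->
  (m %| x1 ^+ 2 - x2 ^+ 2)%Z ->
  exists d : nat, exists n e h : int,
   [/\ (d %| m)%N, d%:Z ^+ 2 * e - n * (m * m.+1)%N%:Z = d%:Z, d%:Z * h = m%:Z * n &
     (m %| x1 + 2 * h * x1 - x2)%Z].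
Proof.
move=> hm; rewrite subr_sqr => /(squarefree_split hm)[g [d [mE gd gP dQ]]].
have [|n [e he]] := @AtkinLehner_coefs d (g * m.+1).
  by rewrite coprimeMr coprime_sym gd (coprime_dvdl _ (coprimenS m)) // mE dvdn_mull.
exists d, n, e, (g%:Z * n); split.
- by rewrite mE dvdn_mull.
- by rewrite -[RHS]mulr1 -he {1}mE !PoszM; ring.
- by rewrite mE PoszM; ring.
have dh : (d %| g%:Z * n + 1)%Z.
  apply/dvdzP; exists (e - g%:Z * n * g%:Z).
  by rewrite -he {1}mE !PoszM -addn1 PoszD PoszM; ring.
rewrite {1}mE; apply: dvdz_coprime => //.
  have -> : x1 + 2 * (g%:Z * n) * x1 - x2 = (x1 - x2) + g%:Z * (n * 2 * x1) by ring.
  by rewrite rpredD ?dvdz_mulr.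
have -> : x1 + 2 * (g%:Z * n) * x1 - x2 = (g%:Z * n + 1) * (2 * x1) - (x1 + x2) by ring.
by rewrite rpredB ?dvdz_mulr.
Qed.


Lemma even_or_odd (x : int) : exists a, x = 2 * a \/ x = 2 * a + 1.
Proof. by exists (x %/ 2)%Z; lia. Qed.

(** For m = 2 mod 4, the residue of x^2 + m y^2 mod 4 determines the parities of x and y. For m = 1
    mod 4 it only confuses (odd, even) with (even, odd), which is the second alternative. *)
Lemma parity_of_norms (m : nat) (x1 y1 x2 y2 k : int) :
  (m %% 4 = 1 \/ m %% 4 = 2)%N ->
  x1 ^+ 2 + m%:Z * y1 ^+ 2 - x2 ^+ 2 - m%:Z * y2 ^+ 2 = (4 * m)%:Z * k ->
  (exists A b, x1 = x2 + 2 * A /\ y1 = y2 + 2 * b) \/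
  (exists a b c m', [/\ x1 = x2 + 2 * a + 1, y1 = y2 + 2 * b + 1,
     x1 = y1 + 2 * c + 1 & m%:Z = 4 * m' + 1]).
Proof.
move=> hm.
have [q mq] : exists q : int, m%:Z = 4 * q + 1 \/ m%:Z = 4 * q + 2.
  by exists (m %/ 4)%N; lia.
have -> : (4 * m)%:Z = 4 * m%:Z by lia.
set M := m%:Z in mq *.
have [a ha] := even_or_odd x1; have [b hb] := even_or_odd x2.
have [c hc] := even_or_odd y1; have [d hd] := even_or_odd y2.
case: mq => mq; rewrite mq; case: ha => ->; case: hb => ->; case: hc => ->; case: hd => ->.
all: rewrite !expr2 => h.
(* Each parity pattern fixes the witnesses; an offset -1 appears where an even number is to equal an
   odd number plus an odd difference. *)
all: first [left; exists (a - b), (c - d); split; lia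
 | right; exists (a - b), (c - d), (a - c), q; split; lia
 | right; exists (a - b - 1), (c - d), (a - c), q; split; lia
 | right; exists (a - b), (c - d - 1), (a - c), q; split; lia
 | right; exists (a - b - 1), (c - d - 1), (a - c), q; split; lia
 | right; exists (a - b), (c - d), (a - c - 1), q; split; lia
 | right; exists (a - b - 1), (c - d), (a - c - 1), q; split; lia
 | right; exists (a - b), (c - d - 1), (a - c - 1), q; split; lia
 | right; exists (a - b - 1), (c - d - 1), (a - c - 1), q; split; lia
 | exfalso; lia | exfalso; nia].
Qed.

Lemma eq_from_diff (V : zmodType) (a b c d : V) : c = d -> a - b = c - d -> a = b.
Proof. by move=> ->; rewrite subrr => /eqP; rewrite subr_eq0 => /eqP. Qed.

(** Here s = x + y w with w = sqrt(-m), and congruence modulo 2 w in Z[w] means modulo 2 m for x and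
    modulo 2 for y. Equal parities are handled by a divisor d of m, swapped parities by an even
    d. *)
Lemma AtkinLehner_even_disc (m : nat) (x1 y1 x2 y2 k : int) : squarefree m ->
  (m %% 4 != 3)%N ->
  x1 ^+ 2 + m%:Z * y1 ^+ 2 - x2 ^+ 2 - m%:Z * y2 ^+ 2 = (4 * m)%:Z * k ->
  exists d : nat, exists n e H : int,
   [/\ squarefree d, (d %| 4 * m)%N,
     d%:Z ^+ 2 * e - n * (m * m.+1)%N%:Z = d%:Z, d%:Z * H = (2 * m)%:Z * n &
     ((2 * m)%N %| x1 + H * (x1 - m%:Z * y1) - x2)%Z /\
     (2 %| y1 - H * (x1 - m%:Z * y1) - y2)%Z].
Proof.
move=> hm m3 hk.
have c4 : (4 * m)%:Z = 4 * m%:Z by lia.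
have m4 : (m %% 4 = 1 \/ m %% 4 = 2)%N.
  have m40 : (m %% 4 != 0)%N by apply/negP => /(hm 2%N).
  lia.
have [[A [b [xA yb]]]|[a [b [c [m' [xa yb xc m'E]]]]]] := parity_of_norms m4 hk.
  (* The product A (A + x2) is (x1^2 - x2^2) / 4. *)
  have AB : (m %| A * (A + x2))%Z.
    apply/dvdzP; exists (k - b * y2 - b * b).
    apply: (@mulfI _ 4) => //; apply: eq_from_diff hk _.
    by rewrite xA yb c4; ring.
  have [g [d [mE gd gP dQ]]] := squarefree_split hm AB.
  have [|n [e he]] := @AtkinLehner_coefs d (g * m.+1).
    by rewrite coprimeMr coprime_sym gd (coprime_dvdl _ (coprimenS m)) // mE dvdn_mull.
  (* H is even, so y keeps its parity; again g n is 0 modulo g and -1 modulo d. *)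
  exists d, n, e, (2 * (g%:Z * n)); split.
  - by apply: squarefree_dvd hm _; rewrite mE dvdn_mull.
  - by rewrite dvdn_mull // mE dvdn_mull.
  - by rewrite -[RHS]mulr1 -he {1}mE !PoszM; ring.
  - by rewrite mE !PoszM; ring.
  have dh : (d %| g%:Z * n + 1)%Z.
    apply/dvdzP; exists (e - g%:Z * n * g%:Z).
    by rewrite -he {1}mE !PoszM -addn1 PoszD PoszM; ring.
  split; last first.
    by apply/dvdzP; exists (b - g%:Z * n * (x1 - m%:Z * y1)); rewrite yb; ring.
  have -> : x1 + 2 * (g%:Z * n) * (x1 - m%:Z * y1) - x2 =
    2 * (A + g%:Z * n * (2 * A + x2) - m%:Z * (g%:Z * n * y1)) by rewrite xA; ring.
  rewrite PoszM dvdz_mul // rpredB ?dvdz_mulr //.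
  rewrite {1}mE; apply: dvdz_coprime => //.
    by rewrite rpredD // -mulrA dvdz_mulr.
  have -> : A + g%:Z * n * (2 * A + x2) =
    (g%:Z * n + 1) * A + (A + x2) * (g%:Z * n) by ring.
  by rewrite rpredD ?dvdz_mulr.
have AB : (m %| (x1 - x2) * (x1 + x2))%Z.
  apply/dvdzP; exists (4 * k - (y1 - y2) * (y1 + y2)).
  by apply: eq_from_diff hk _; rewrite c4; ring.
have [g [d [mE gd gP dQ]]] := squarefree_split hm AB.
(* Swapped parities occur only for m = 1 mod 4, where m + 1 is twice an odd number. *)
have [l lE] : exists l, m.+1 = (2 * l)%N /\ odd l.
  by exists (m.+1)./2; move: m'E; clear; lia.
have modd : odd m by move: m'E; clear; lia.
have dl : coprime d l.
  apply: (@coprime_dvdr _ m.+1); first by rewrite lE.1 dvdn_mull.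
  by rewrite (coprime_dvdl _ (coprimenS m)) // mE dvdn_mull.
have [|n [e he]] := @AtkinLehner_coefs (2 * d) (g * l).
  rewrite coprimeMl !coprimeMr !coprime2n lE.2 (coprime_sym d) gd dl !andbT.
  by move: modd; rewrite {1}mE oddM => /andP[].
(* The relation 2 d e - n g l = 1 makes H = g n odd, which swaps both parities because x1 - m y1 is
   odd. Modulo d, where 2 l = m + 1 is 1, it gives H = -2, so that 1 + H is the sign -1. *)
exists (2 * d)%N, n, e, (g%:Z * n); split.
- move=> q; case: (boolP (odd q)) => oq.
    rewrite Gauss_dvdr ?coprimeXl ?coprimen2 // => qd; apply: hm.
    by rewrite mE dvdn_mull.
  move=> qd; have : (2 ^ 2 %| 2 * d)%N.
    by apply: dvdn_trans qd; rewrite dvdn_exp2r // dvdn2.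
  rewrite expnS dvdn_pmul2l // expn1 dvdn2; move: modd; rewrite mE oddM.
  by case: odd => //=; case: odd.
- by rewrite mE (mulnA 4) (mulnC 4) -mulnA dvdn_mull // dvdn_mul.
- by rewrite lE.1 -[RHS]mulr1 -he {1}mE !PoszM; ring.
- by rewrite mE !PoszM; ring.
have c2 : (2 * d)%:Z = 2 * d%:Z by clear; lia.
have cgl : (g * l)%:Z = g%:Z * l%:Z by rewrite PoszM.
have nodd : exists j, g%:Z * n = 2 * j + 1.
  have [j [hj|hj]] := even_or_odd (g%:Z * n); last by exists j.
  have : 2 * (d%:Z * e - j * l%:Z) = 1.
    apply: etrans he; rewrite c2 cgl.
    have -> : n * (g%:Z * l%:Z) = g%:Z * n * l%:Z by ring.
    by rewrite hj; ring.
  by clear; lia.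
have dh : (d %| g%:Z * n + 2)%Z.
  have lm : 2 * l%:Z = m%:Z + 1 by have := lE.1; clear; lia.
  apply/dvdzP; exists (4 * e - g%:Z * n * g%:Z).
  have -> : g%:Z * n + 2 = g%:Z * n + 2 * (d%:Z * 2 * e - n * (g%:Z * l%:Z)).
    rewrite c2 cgl in he.
    by apply: (eq_from_diff (congr1 ( *%R 2) (esym he))); ring.
  have -> : g%:Z * n + 2 * (d%:Z * 2 * e - n * (g%:Z * l%:Z)) =
      g%:Z * n + 4 * d%:Z * e - n * g%:Z * (2 * l%:Z) by ring.
  by rewrite lm mE PoszM; ring.
have [j hj] := nodd.
have u : y1 - y2 = 2 * b + 1 by rewrite yb; ring.
have v : x1 - m%:Z * y1 = 2 * c + 1 - 4 * m' * y1 by rewrite xc m'E; ring.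
have w : x1 - x2 = 2 * a + 1 by rewrite xa; ring.
have mdv z : (g %| z)%Z -> (d %| z)%Z -> (m %| z)%Z.
  by move=> gz dz; rewrite mE; apply: dvdz_coprime.
split; last first.
  rewrite hj (_ : _ - _ - _ = (y1 - y2) - (2 * j + 1) * (x1 - m%:Z * y1)); last by ring.
  rewrite u v; apply/dvdzP; exists (b - j * (2 * c + 1 - 4 * m' * y1) - c + 2 * m' * y1).
  by ring.
rewrite mulnC; apply: dvdz_coprime; last first.
- rewrite hj addrAC w v; apply/dvdzP.
  exists (a + j * (2 * c + 1 - 4 * m' * y1) + c - 2 * m' * y1 + 1).
  by ring.
- apply: mdv.
    have -> : x1 + g%:Z * n * (x1 - m%:Z * y1) - x2 =
        (x1 - x2) + g%:Z * (n * (x1 - m%:Z * y1)) by ring.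
    by rewrite rpredD // dvdz_mulr.
  have -> : x1 + g%:Z * n * (x1 - m%:Z * y1) - x2 =
    (g%:Z * n + 2) * x1 - (x1 + x2) - m%:Z * (g%:Z * n * y1) by ring.
  by rewrite !rpredB // dvdz_mulr // mE PoszM dvdz_mull.
- by rewrite coprimen2.
Qed.

(** * The ring of integers and its dual *)

(** Gauss's lemma: X - q is a rational multiple of an integer polynomial dividing the monic p over
    the integers, hence with leading coefficient 1 or -1. *)
Lemma integral_rat_int (F : numFieldType) (q : rat) :
  integralOver (intr : int -> F) (ratr q) -> exists k : int, q = k%:~R.
Proof.
move=> [p p_monic].
have -> : map_poly (intr : int -> F) p = map_poly ratr (map_poly intr p).
  by rewrite -map_poly_comp; apply: eq_map_poly => x /=; rewrite ratr_int.
rewrite fmorph_root -dvdp_XsubCl => /dvdpP_rat_int[p1 [a a0 pE] [r rE]].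
have lead1 : lead_coef p1 * lead_coef r = 1.
  by rewrite -lead_coefM -rE (monicP p_monic).
have lead2 : lead_coef p1 ^+ 2 = 1.
  have := congr1 absz lead1; rewrite abszM => /eqP; rewrite muln_eq1 => /andP[/eqP h _].
  by case: (lead_coef p1) h => [[|[|?]]|[|?]].
exists (- (lead_coef p1 * p1`_0)).
have aE : a * (lead_coef p1)%:~R = 1.
  have := congr1 lead_coef pE; rewrite lead_coefXsubC lead_coefZ => h.
  apply: etrans (esym h); congr (a * _); apply/esym.
  by apply: lead_coef_map_inj => //; apply: intr_inj.
have a_lead : a = (lead_coef p1)%:~R.
  have := congr1 (fun x : int => a * x%:~R) lead2.
  by rewrite expr2 intrM mulrA aE mul1r => ->; apply/esym/mulr1.
have := congr1 (fun p : {poly rat} => p`_0) pE.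
rewrite coefB coefX coefC coefZ coef_map /= sub0r a_lead intrN intrM => <-.
by rewrite opprK.
Qed.

(** The denominator is prime to the numerator, so its square divides m. *)
Lemma rat_sqr_squarefree (m : nat) (q : rat) (k : int) : squarefree m ->
  q ^+ 2 * m%:R = k%:~R -> exists y : int, q = y%:~R.
Proof.
move=> hm; rewrite -[q]divq_num_den; set n := numq q; set d := denq q.
have d0 : d%:~R != 0 :> rat by rewrite intr_eq0 denq_neq0.
move=> h.
have : n ^+ 2 * m%:Z = k * d ^+ 2.
  apply: (@intr_inj rat); rewrite !expr2 !intrM -h -pmulrn.
  by field.
move/(congr1 absz); rewrite !expr2 !abszM absz_nat !mulnn => hnat.
have : (`|d| ^ 2 %| m)%N.
  have cop : coprime (`|d| ^ 2) (`|n| ^ 2).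
    by apply/coprimeXl/coprimeXr; rewrite coprime_sym coprime_num_den.
  by rewrite -(Gauss_dvdr _ cop) hnat dvdn_mull.
move/hm => d1; exists n.
have -> : d = 1 by have := denq_gt0 q; rewrite -/d; case: (d) d1 => [[|[|]]|] //.
by rewrite divr1.
Qed.

Section QuadraticOrder.
Variables (R : realType) (m : nat).
Hypothesis hm : squarefree m.
Let w : Cplx R := sqrt_neg R m.

Lemma sqr_sqrt_neg : w ^+ 2 = - m%:R.
Proof. exact: sqrtCK. Qed.

Lemma sqrt_neg_neq0 : w != 0.
Proof. by rewrite sqrtC_eq0 oppr_eq0 pnatr_eq0 -lt0n squarefree_gt0. Qed.

Lemma conj_neg_sqr (z : Cplx R) (n : nat) : z ^+ 2 = - n%:R -> z^* = - z.
Proof.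
move=> zn; have [->|z0] := eqVneq z 0; first by rewrite rmorph0 oppr0.
apply: (mulfI z0); by rewrite -normCK mulrN -expr2 zn opprK -normrX zn normrN normr_nat.
Qed.

Lemma conj_sqrt_neg : w^* = - w.
Proof. exact: conj_neg_sqr sqr_sqrt_neg. Qed.

Lemma conj_ratr (x : rat) : (ratr x : Cplx R)^* = ratr x.
Proof. by rewrite fmorph_rat. Qed.

Lemma conj_quad (x y : rat) : (ratr x + ratr y * w)^* = ratr x - ratr y * w.
Proof.
by rewrite [LHS]rmorphD [X in _ + X]rmorphM /= !conj_ratr conj_sqrt_neg mulrN.
Qed.

Lemma quadKD (z u : Cplx R) : quadK m z -> quadK m u -> quadK m (z + u).
Proof.
move=> [x [y ->]] [x' [y' ->]]; exists (x + x'), (y + y').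
by rewrite !rmorphD /=; ring.
Qed.

Lemma quadKM (z u : Cplx R) : quadK m z -> quadK m u -> quadK m (z * u).
Proof.
move=> [x [y ->]] [x' [y' ->]]; exists (x * x' - y * y' * m%:R), (x * y' + y * x').
rewrite !(rmorphD, rmorphM, rmorphN) /= rmorph_nat -/w.
have -> : m%:R = - w ^+ 2 by rewrite sqr_sqrt_neg opprK.
by ring.
Qed.

Lemma quadKJ (z : Cplx R) : quadK m z -> quadK m z^*.
Proof.
move=> [x [y ->]]; exists x, (- y).
by rewrite -/w conj_quad rmorphN mulNr.
Qed.

Lemma ringO_int (k : int) : ringO m (k%:~R : Cplx R).
Proof.
split; last exact: integral_id.
by exists k%:~R, 0; rewrite rmorph0 mul0r addr0 ratr_int.
Qed.

Lemma ringOD (z u : Cplx R) : ringO m z -> ringO m u -> ringO m (z + u).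
Proof. by move=> [hz iz] [hu iu]; split; [apply: quadKD|apply: integral_add]. Qed.

Lemma ringOM (z u : Cplx R) : ringO m z -> ringO m u -> ringO m (z * u).
Proof. by move=> [hz iz] [hu iu]; split; [apply: quadKM|apply: integral_mul]. Qed.

Lemma ringON (z : Cplx R) : ringO m z -> ringO m (- z).
Proof.
by move=> hz; rewrite -mulN1r; apply: ringOM => //; apply: (ringO_int (-1)).
Qed.

Lemma ringOJ (z : Cplx R) : ringO m z -> ringO m z^*.
Proof.
move=> [hz [p pm pz]]; split; first exact: quadKJ.
exists p => //; have := pz; rewrite -(fmorph_root Num.conj) -map_poly_comp.
by congr (root _ _); apply: eq_map_poly => x /=; rewrite rmorph_int.
Qed.

Lemma ringO_monic_quadratic (z : Cplx R) (a b : int) : quadK m z ->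
  z ^+ 2 + a%:~R * z + b%:~R = 0 -> ringO m z.
Proof.
move=> hz h; split => //; exists ('X^2 + (a *: 'X + b%:P)).
  rewrite monicE lead_coefDl ?lead_coefXn // size_polyXn.
  rewrite (leq_ltn_trans (size_polyD _ _)) // gtn_max.
  rewrite (leq_ltn_trans (size_scale_leq _ _)) ?size_polyX //.
  by rewrite (leq_ltn_trans (size_polyC_leq1 _)).
rewrite /root !rmorphD /= map_polyXn map_polyZ /= map_polyX map_polyC /=.
by rewrite !hornerE; apply/eqP; apply: etrans h; rewrite expr2.
Qed.

Lemma ringO_sqrt_neg : ringO m w.
Proof.
apply: (@ringO_monic_quadratic _ 0 m%:Z).
  by exists 0, 1; rewrite rmorph0 rmorph1 mul1r add0r.
by rewrite mul0r addr0 sqr_sqrt_neg -pmulrn addNr.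
Qed.

Lemma ringO_real_int (z : Cplx R) : ringO m z -> z^* = z -> exists k : int, z = k%:~R.
Proof.
move=> [[x [y zE]] iz] zJ.
have y0 : ratr y * w = 0 :> Cplx R.
  move: zJ; rewrite zE conj_quad => /addrI.
  by move=> /eqP; rewrite eq_sym -addr_eq0 -mulr2n mulrn_eq0 /= => /eqP.
move: iz zE; rewrite -/w y0 addr0 => iz zE; rewrite zE in iz *.
have [k ->] := integral_rat_int iz.
by exists k; rewrite ratr_int.
Qed.

Lemma ringO_trace (z : Cplx R) : ringO m z -> exists k : int, z + z^* = k%:~R.
Proof.
move=> hz; apply: ringO_real_int; first by apply: ringOD => //; apply: ringOJ.
by rewrite rmorphD /= conjCK addrC.
Qed.

Lemma ringO_norm (z : Cplx R) : ringO m z -> exists k : int, z * z^* = k%:~R.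
Proof.
move=> hz; apply: ringO_real_int; first by apply: ringOM => //; apply: ringOJ.
by rewrite rmorphM /= conjCK mulrC.
Qed.

(** Here x is the trace and k the norm of z = p + q w. As (2 q)^2 m = 4 k - x^2 is an integer and m
    is squarefree, y = 2 q is an integer too. This describes O uniformly in m mod 4. *)
Lemma ringO_half_int (z : Cplx R) : ringO m z -> exists x y k : int,
  2 * z = x%:~R + y%:~R * w /\ x ^+ 2 + m%:Z * y ^+ 2 = 4 * k.
Proof.
move=> hz; have [X hX] := ringO_trace hz; have [k hk] := ringO_norm hz.
have [[p [q zE]] _] := hz; rewrite -/w in zE.
have zJ : z^* = ratr p - ratr q * w.
  by rewrite zE conj_quad.
have pX : 2 * p = X%:~R.
  apply: (fmorph_inj (ratr : rat -> Cplx R)); rewrite rmorphM rmorph_nat /= ratr_int.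
  by rewrite -hX zJ zE; ring.
have pq : p ^+ 2 + m%:R * q ^+ 2 = k%:~R.
  apply: (fmorph_inj (ratr : rat -> Cplx R)).
  rewrite !expr2 rmorphD !rmorphM /= rmorph_nat ratr_int -hk zJ zE.
  have -> : m%:R = - w ^+ 2 by rewrite sqr_sqrt_neg opprK.
  by ring.
have qY : (2 * q) ^+ 2 * m%:R = (4 * k - X ^+ 2)%:~R.
  by rewrite intrB !expr2 !intrM -pX -pq; ring.
have [Y hY] := rat_sqr_squarefree hm qY.
exists X, Y, k; split.
  rewrite zE -(ratr_int _ X) -(ratr_int _ Y) -pX -hY !rmorphM /= rmorph_nat; ring.
apply: (@intr_inj rat); rewrite !expr2 intrD !intrM -hY -pX -pq -pmulrn.
by ring.
Qed.

End QuadraticOrder.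

Lemma squarefree_mod4 (m : nat) : squarefree m -> (m %% 4 != 3)%N ->
  (m %% 4 = 1 \/ m %% 4 = 2)%N.
Proof.
move=> hm m3; have m40 : (m %% 4 != 0)%N by apply/negP => /(hm 2%N).
lia.
Qed.

Lemma even_of_norm (m : nat) (x y k : int) : (m %% 4 = 1 \/ m %% 4 = 2)%N ->
  x ^+ 2 + m%:Z * y ^+ 2 = 4 * k -> exists a b, x = 2 * a /\ y = 2 * b.
Proof.
move=> hm.
have [q mq] : exists q : int, m%:Z = 4 * q + 1 \/ m%:Z = 4 * q + 2.
  by exists (m %/ 4)%N; lia.
set M := m%:Z in mq *.
have [a ha] := even_or_odd x; have [b hb] := even_or_odd y.
case: mq => mq; rewrite mq; case: ha => ->; case: hb => ->; rewrite !expr2 => h.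
all: first [by exists a, b | exfalso; lia].
Qed.

Section DualLattice.
Variables (R : realType) (m : nat).
Hypothesis hm : squarefree m.
Let w : Cplx R := sqrt_neg R m.
Let kappa : Cplx R := if (m %% 4)%N == 3 then 1 else 2.

Let w0 : w != 0. Proof. exact: sqrt_neg_neq0. Qed.
Let k0 : kappa != 0.
Proof. by rewrite /kappa; case: ifP => _; rewrite ?oner_eq0 ?pnatr_eq0. Qed.

Lemma sqr_kappa_w : (kappa * w) ^+ 2 = (disc m)%:~R.
Proof.
rewrite exprMn sqr_sqrt_neg /kappa /disc; case: ifP => _.
  by rewrite expr1n mul1r intrN -pmulrn.
by rewrite intrN -pmulrn mulrN natrM; congr (- (_ * _)); rewrite expr2; ring.
Qed.

(** [sqrtC] selects one of the two roots; the sign c is left undetermined and is absorbed by O in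
    [dualOP]. *)
Lemma sqrtC_disc : exists2 c : int, c ^+ 2 = 1 &
  sqrtC (disc m)%:~R = c%:~R * (kappa * w).
Proof.
have : sqrtC (disc m)%:~R ^+ 2 = (kappa * w) ^+ 2 by rewrite sqrtCK sqr_kappa_w.
move/eqP; rewrite eqf_sqr => /orP[] /eqP ->; first by exists 1; rewrite ?mul1r.
by exists (-1); rewrite ?mulN1r.
Qed.

Lemma dualOP (t : Cplx R) :
  dualO m t <-> exists2 s, ringO m s & t = (kappa * w)^-1 * s.
Proof.
have [c c1 dE] := sqrtC_disc; rewrite /dualO /= dE.
have cc : c%:~R * c%:~R = 1 :> Cplx R by rewrite -intrM -expr2 c1.
have cV : c%:~R^-1 = c%:~R :> Cplx R.
  have c0 : c%:~R != 0 :> Cplx R.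
    by apply: contra_eq_neq cc => ->; rewrite mul0r eq_sym oner_neq0.
  by apply: (mulfI c0); rewrite cc divff.
split=> -[s hs ->].
  exists (c%:~R * s); first by apply: ringOM => //; apply: ringO_int.
  by rewrite invfM cV -mulrA mulrCA.
exists (c%:~R * s); first by apply: ringOM => //; apply: ringO_int.
rewrite [in RHS]invfM cV; transitivity (c%:~R * c%:~R * ((kappa * w)^-1 * s)).
  by rewrite cc mul1r.
by ring.
Qed.

Lemma dualOD (t u : Cplx R) : dualO m t -> dualO m u -> dualO m (t + u).
Proof.
move=> [s hs ->] [s' hs' ->]; exists (s + s'); first exact: ringOD.
by rewrite mulrDr.
Qed.

Lemma dualOM (z t : Cplx R) : ringO m z -> dualO m t -> dualO m (z * t).
Proof.
by move=> hz [s hs ->]; exists (z * s); [apply: ringOM|rewrite mulrCA].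
Qed.

Lemma dualOJ (t : Cplx R) : dualO m t -> dualO m t^*.
Proof.
move=> /dualOP[s hs ->]; apply/dualOP; exists (- s^*); first exact/ringON/ringOJ.
rewrite rmorphM fmorphV rmorphM /= conj_sqrt_neg // -/w.
have -> : kappa^* = kappa by rewrite /kappa; case: ifP => _; rewrite ?rmorph1 ?rmorph_nat.
by rewrite !mulrN invrN mulNr.
Qed.

Lemma dualO_ringO (z : Cplx R) : ringO m z -> dualO m z.
Proof.
move=> hz; apply/dualOP; exists (kappa * w * z); last by rewrite mulKf ?mulf_neq0.
apply: ringOM => //; apply: ringOM; last exact: ringO_sqrt_neg.
by rewrite /kappa; case: ifP => _; [apply: (ringO_int _ _ 1)|apply: (ringO_int _ _ 2)].
Qed.

(** The dual lattice is the inverse different. If t times the conjugate of z is u / (kappa w), the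
    trace is y / kappa, where u = (x + y w) / 2; and y is even when kappa = 2. *)
Lemma dualO_trace (z t : Cplx R) : ringO m z -> dualO m t ->
  exists k : int, t * z^* + t^* * z = k%:~R.
Proof.
move=> hz ht; have /dualOP[u hu tzE] := dualOM (ringOJ hz) ht.
have [x [y [k [uE nE]]]] := ringO_half_int hm hu; rewrite -/w in uE.
have uJ : 2 * u^* = x%:~R - y%:~R * w.
  have := congr1 Num.conj uE; rewrite rmorphM rmorph_nat /= => ->.
  by rewrite rmorphD rmorphM /= !rmorph_int conj_sqrt_neg // mulrN.
have diff : u - u^* = y%:~R * w.
  apply: (mulfI (x := 2)); first by rewrite pnatr_eq0.
  by rewrite mulrBr uE uJ; ring.
have -> : t * z^* + t^* * z = kappa^-1 * y%:~R.
  have -> : t^* * z = (z^* * t)^* by rewrite rmorphM /= conjCK mulrC.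
  rewrite (mulrC t) tzE rmorphM fmorphV rmorphM /= conj_sqrt_neg // -/w.
  have -> : kappa^* = kappa by rewrite /kappa; case: ifP => _; rewrite ?rmorph1 ?rmorph_nat.
  rewrite mulrN invrN mulNr -mulrBr diff invfM.
  by field; rewrite k0 w0.
rewrite /kappa; case: ifPn => [_|m3]; first by exists y; rewrite invr1 mul1r.
have [a [b [_ ->]]] := even_of_norm (squarefree_mod4 hm m3) nE.
by exists b; rewrite intrM mulKf ?pnatr_eq0.
Qed.

Lemma Lambda2P (k l : int) (t : Cplx R) : dualO m t ->
  Lambda2 m (mx2 k%:~R t t^* l%:~R).
Proof. by move=> ht; exists k, l; exists t. Qed.

(** * Action of the matrices V_d on Hermitian matrices *)

Section AtkinLehnerConj.
Variables (d : nat) (p q : int).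
Hypotheses (d_gt0 : (0 < d)%N) (hp : d%:Z * p = (m * m.+1)%N%:Z)
  (hq : d%:Z * q = (2 * m)%N%:Z).
Let D : Cplx R := d%:R.
Let M : Cplx R := m%:R.
Let om : Cplx R := M + w.
Let om' : Cplx R := M - w.

(** The factor p - q (1 - w) is (m + w)^2 / d, and p is the norm of m + w divided by d; the two
    divisibility hypotheses make both integral. *)
Definition AtkinLehner_offdiag (a b c e k l : int) (t : Cplx R) : Cplx R :=
  a%:~R * b%:~R * k%:~R * om + a%:~R * e%:~R * D * t
  + b%:~R * c%:~R * (p%:~R - q%:~R * (1 - w)) * t^* + c%:~R * e%:~R * l%:~R * om.

Lemma AtkinLehner_conj (a b c e k l tau : int) (t : Cplx R) (V : 'M[Cplx R]_2) :
  V = (sqrtC D)^-1 *: mx2 (a%:~R * D) (b%:~R * om) (c%:~R * om') (e%:~R * D) ->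
  t * om' + t^* * om = tau%:~R ->
  adjmx V *m mx2 k%:~R t t^* l%:~R *m V =
    mx2 (a ^+ 2 * d%:Z * k + a * c * tau + c ^+ 2 * p * l)%:~R
        (AtkinLehner_offdiag a b c e k l t)
        (AtkinLehner_offdiag a b c e k l t)^*
        (b ^+ 2 * p * k + b * e * tau + e ^+ 2 * d%:Z * l)%:~R.
Proof.
move=> VE htau.
have D0 : D != 0 by rewrite pnatr_eq0 -lt0n.
have hp' : D * p%:~R = M * (M + 1).
  have := congr1 (fun z : int => z%:~R : Cplx R) hp.
  by rewrite /= intrM -!pmulrn natrM -addn1 natrD.
have hq' : D * q%:~R = 2 * M.
  have := congr1 (fun z : int => z%:~R : Cplx R) hq.
  by rewrite /= intrM -!pmulrn natrM.
have omJ : om^* = om' by rewrite rmorphD rmorph_nat /= conj_sqrt_neg.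
have om'J : om'^* = om by rewrite -omJ conjCK.
have wE : w ^+ 2 = - M := sqr_sqrt_neg R m.
have om_norm : om * om' = D * p%:~R.
  have -> : om * om' = M ^+ 2 - w ^+ 2 by rewrite /om /om'; ring.
  by rewrite hp' wE; ring.
have om_sqr : om ^+ 2 = D * (p%:~R - q%:~R * (1 - w)).
  have -> : om ^+ 2 = M ^+ 2 + 2 * M * w + w ^+ 2 by rewrite /om; ring.
  by rewrite mulrBr mulrA hp' hq' wE; ring.
set t' := AtkinLehner_offdiag a b c e k l t.
have t'J : t'^* = a%:~R * b%:~R * k%:~R * om' + a%:~R * e%:~R * D * t^*
  + b%:~R * c%:~R * (p%:~R - q%:~R * (1 + w)) * t + c%:~R * e%:~R * l%:~R * om'.
  rewrite /t' /AtkinLehner_offdiag !(rmorphD Num.conj) /= !(rmorphM Num.conj) /= omJ conjCK.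
  rewrite (rmorphB Num.conj) (rmorphM Num.conj) (rmorphB Num.conj) /= conj_sqrt_neg //.
  by rewrite !rmorph_int rmorph1 rmorph_nat opprK.
have om'_sqr : om' ^+ 2 = D * (p%:~R - q%:~R * (1 + w)).
  have -> : om' ^+ 2 = M ^+ 2 - 2 * M * w + w ^+ 2 by rewrite /om'; ring.
  by rewrite mulrBr mulrA hp' hq' wE; ring.
have sD : (sqrtC D)^-1 ^+ 2 = D^-1 by rewrite exprVn sqrtCK.
have sJ : ((sqrtC D)^-1)^* = (sqrtC D)^-1.
  by apply: conj_Creal; rewrite realV ger0_real // sqrtC_ge0 ler0n.
rewrite VE adjmxZ sJ -scalemxAl -scalemxAr -scalemxAl scalerA -expr2 sD.
rewrite adjmx_mx2 !mul_mx2 scale_mx2.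
rewrite !rmorphM /= !rmorph_int rmorph_nat omJ om'J.
rewrite !(intrD, intrM) -/D -!pmulrn -/D -htau t'J.
(* After multiplication by D, each entry reduces to one of the three product formulas for [om] and
   [om']. *)
congr mx2.
- apply: (mulfI D0); rewrite mulVKf //.
  by apply: eq_from_diff (congr1 ( *%R (c%:~R ^+ 2 * l%:~R)) om_norm) _; ring.
- apply: (mulfI D0); rewrite mulVKf // /t' /AtkinLehner_offdiag.
  by apply: eq_from_diff (congr1 ( *%R (b%:~R * c%:~R * t^*)) om_sqr) _; ring.
- apply: (mulfI D0); rewrite mulVKf //.
  by apply: eq_from_diff (congr1 ( *%R (b%:~R * c%:~R * t)) om'_sqr) _; ring.
- apply: (mulfI D0); rewrite mulVKf //.
  by apply: eq_from_diff (congr1 ( *%R (b%:~R ^+ 2 * k%:~R)) om_norm) _; ring.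
Qed.

Lemma AtkinLehner_stable (V T : 'M[Cplx R]_2) :
  AtkinLehner m d V -> Lambda2 m T -> Lambda2 m (adjmx V *m T *m V).
Proof.
move=> [_ [a [b [c [e VE]]]]] [k [l [t ht ->]]].
have om_ring : ringO m om.
  by apply: ringOD => //; [apply: (ringO_int _ _ m)|apply: ringO_sqrt_neg].
have [tau htau] := dualO_trace om_ring ht.
rewrite (rmorphD Num.conj) (rmorph_nat Num.conj) /= conj_sqrt_neg in htau.
rewrite (AtkinLehner_conj _ _ VE htau); apply: Lambda2P.
have q_ring : ringO m (p%:~R - q%:~R * (1 - w)).
  apply: ringOD => //; first exact: ringO_int.
  apply: ringON; apply: ringOM; first exact: ringO_int.
  by apply: ringOD; [apply: (ringO_int _ _ 1)|apply: ringON; apply: ringO_sqrt_neg].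
have int_ring (i : int) : ringO m (i%:~R : Cplx R) by apply: ringO_int.
have coef_ring (i j h : int) (z : Cplx R) :
  ringO m z -> ringO m (i%:~R * j%:~R * h%:~R * z).
  by move=> hz; do !apply: ringOM => //.
have coef2_ring (i j : int) (z : Cplx R) : ringO m z -> ringO m (i%:~R * j%:~R * z).
  by move=> hz; do !apply: ringOM => //.
apply: dualOD; last exact/dualO_ringO/coef_ring.
apply: dualOD; last by apply: dualOM; [apply: coef2_ring|apply: dualOJ].
apply: dualOD; first exact/dualO_ringO/coef_ring.
by apply: dualOM => //; apply: coef2_ring; apply: (ringO_int _ _ d).
Qed.

End AtkinLehnerConj.

End DualLattice.

(** * Krieg's space is invariant *)

(** An odd d divides m. An even d is 2 d' with d' odd and dividing m, and m (m + 1) is even. These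
    divisibilities are what stability of the lattice under V_d rests on. *)
Lemma squarefree_dvd_disc (m d : nat) : squarefree m -> squarefree d ->
  (d %| `|disc m|)%N ->
  exists p q : int, d%:Z * p = (m * m.+1)%N%:Z /\ d%:Z * q = (2 * m)%N%:Z.
Proof.
move=> hm hd; rewrite /disc => dvd.
suff [/dvdnP[p ->] /dvdnP[q ->]] : (d %| m * m.+1)%N /\ (d %| 2 * m)%N.
  by exists p, q; rewrite !PoszM !(mulrC d%:Z).
case: ifP dvd => _; rewrite abszN absz_nat => dvd; first by rewrite dvdn_mulr // dvdn_mull.
case: (boolP (odd d)) => od.
  have dm : (d %| m)%N by rewrite -(@Gauss_dvdr _ (2 ^ 2)) // coprimeXr ?coprimen2.
  by rewrite dvdn_mulr // dvdn_mull.
have [d' dE] : exists d', d = (2 * d')%N by exists d./2; lia.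
have od' : odd d'.
  apply: contraT; rewrite -dvdn2 => h; have : (2 ^ 2 %| d)%N by rewrite dE dvdn_mul.
  by move/hd.
have dm : (d' %| m)%N.
  move: dvd; have -> : (4 * m = 2 * (2 * m))%N by rewrite mulnA.
  rewrite dE dvdn_pmul2l //.
  by rewrite Gauss_dvdr // coprimen2.
split; last by rewrite dE dvdn_pmul2l.
have even_mm : (2 %| m * m.+1)%N by rewrite dvdn2 oddM /=; case: odd.
by rewrite dE Gauss_dvd ?coprime2n // even_mm dvdn_mulr.
Qed.

(** The adjugate has the same shape, with a and e exchanged and b, c negated. *)
Lemma AtkinLehner_inv (R : realType) (m d : nat) (V : 'M[Cplx R]_2) :
  AtkinLehner m d V ->
  exists V', [/\ AtkinLehner m d V', V *m V' = 1%:M & V' *m V = 1%:M].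
Proof.
case=> detV [a [b [c [e VE]]]].
pose V' := (sqrtC d%:R)^-1 *:
  mx2 (e%:~R * d%:R) ((- b)%:~R * (m%:R + sqrt_neg R m))
      ((- c)%:~R * (m%:R - sqrt_neg R m)) (a%:~R * d%:R).
have VV' : V *m V' = 1%:M.
  rewrite VE /V' !scale_mx2 !intrN !mulNr !mulrN; apply: mx2_1_unit.
  by move: detV; rewrite VE scale_mx2 det_mx2.
have V'V : V' *m V = 1%:M by apply: mulmx1C.
exists V'; split => //; split; last by exists e, (- b), (- c), a.
by have := congr1 determinant VV'; rewrite det_mulmx detV mul1r det1.
Qed.

Lemma content_conj (R : realType) (m : nat) (V V' T : 'M[Cplx R]_2) :
  V *m V' = 1%:M ->
  (forall T, Lambda2 m T -> Lambda2 m (adjmx V *m T *m V)) ->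
  (forall T, Lambda2 m T -> Lambda2 m (adjmx V' *m T *m V')) ->
  Defs.content m (adjmx V *m T *m V) = Defs.content m T.
Proof.
move=> VV' VL V'L; rewrite /Defs.content.
suff -> : content_cand m (adjmx V *m T *m V) = content_cand m T by [].
apply/seteqP; split=> q [q0 qL]; split => //.
  by have := V'L _ qL; rewrite -scalemxAr -scalemxAl (conj_cancel VV').
by have := VL _ qL; rewrite -scalemxAr -scalemxAl.
Qed.

Lemma krieg_space_DeltaStar (R : realType) (m : nat) (r : int)
    (f : 'M[Cplx R]_2 -> Cplx R) : squarefree m ->
  krieg_space m r f -> modular_form (@DeltaStar R m) r f.
Proof.
move=> hm [[fdiff fmod] [alpha hfa [alphas hal]]]; split=> // M Z.
case=> d [hd [ddisc [G GG [V VAL ->]]]] hZ.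
have [p [q [hp hq]]] := squarefree_dvd_disc hm hd ddisc.
have d0 := squarefree_gt0 hd.
have detV : \det V = 1 by case: VAL.
have [V' [V'AL VV' V'V]] := AtkinLehner_inv VAL.
have VL T := @AtkinLehner_stable _ _ hm _ _ _ d0 hp hq V T VAL.
have V'L T := @AtkinLehner_stable _ _ hm _ _ _ d0 hp hq V' T V'AL.
have hZ' := halfspace_conj detV hZ.
rewrite moebius_mulW ?autfactor_mulW //; last first.
  by apply: autfactor_unit hZ'; case: GG => -[].
rewrite fmod // det_mulmx det_invmx_adj // mulr1; congr (_ * _).
apply: (fourier_conj_invariant hfa detV VV' V'V VL V'L) hZ => T [LT pT].
have [->|T0] := eqVneq T 0; first by rewrite mulmx0 mul0mx.
have LT' : Lambda2_ge0 m (adjmx V' *m T *m V').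
  by split; [apply: V'L|apply: possemidefmx_conj].
have T'0 : adjmx V' *m T *m V' != 0.
  by apply: contra T0 => /eqP h; rewrite -(conj_cancel V'V T) h mulmx0 mul0mx.
rewrite (hal _ LT' T'0) (hal _ (conj LT pT) T0).
rewrite (content_conj _ V'V) // !det_mulmx det_adjmx.
have -> : \det V' = 1 by case: V'AL.
by rewrite conjC1 mul1r mulr1.
Qed.

(** * Block diagonal elements of the modular group *)

Lemma block_mx_symplectic (K : comNzRingType) n (A B A' B' : 'M[K]_n) :
  A' *m B = 1%:M -> B' *m A = 1%:M ->
  block_mx A' 0 0 B' *m block_mx 0 (- 1%:M) 1%:M 0 *m block_mx A 0 0 B =
  block_mx 0 (- 1%:M) 1%:M 0.
Proof.
move=> AB BA; rewrite !mulmx_block.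
by rewrite !(mulmx0, mul0mx, addr0, add0r, mulmxN, mulNmx, mulmx1, oppr0) AB BA.
Qed.

Lemma SU22_Wmx (R : realType) (V : 'M[Cplx R]_2) : \det V = 1 -> SU22 (Wmx V).
Proof.
move=> detV; have Vu : adjmx V \in unitmx.
  by rewrite unitmxE det_adjmx detV conjC1 unitr1.
split; last by rewrite /Wmx det_ublock det_inv det_adjmx detV conjC1 invr1 mulr1.
set B := invmx (adjmx V).
have VB : adjmx V *m B = 1%:M by rewrite mulmxV.
have BV : adjmx B *m V = 1%:M by rewrite -[V in _ *m V]adjmxK -adjmxM VB adjmx1.
have -> : adjmx (Wmx V) = block_mx (adjmx V) 0 0 (adjmx B).
  by rewrite /adjmx /Wmx tr_block_mx map_block_mx !trmx0 !map_mx0.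
by rewrite /Wmx -/B; apply: block_mx_symplectic.
Qed.

Lemma ringO_block (R : realType) (m : nat) (A B : 'M[Cplx R]_2) :
  (forall i j, ringO m (A i j)) -> (forall i j, ringO m (B i j)) ->
  forall i j, ringO m (block_mx A 0 0 B i j).
Proof.
move=> hA hB i j; have h0 : ringO m (0 : Cplx R) by apply: (ringO_int _ _ 0).
rewrite -(splitK i) -(splitK j).
by case: (fintype.split i) => i'; case: (fintype.split j) => j';
  rewrite /unsplit ?(block_mxEul, block_mxEur, block_mxEdl, block_mxEdr, mxE) //.
Qed.

Lemma Gamma2_1 (R : realType) (m : nat) : @Gamma2 R m 1%:M.
Proof.
split; first by split; rewrite ?det1 // adjmx1 mul1mx mulmx1.
by move=> i j; rewrite mxE; case: eqP => _; [apply: (ringO_int _ _ 1)|apply: (ringO_int _ _ 0)].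
Qed.

Lemma Gamma2_Wmx (R : realType) (m : nat) (V V' : 'M[Cplx R]_2) :
  \det V = 1 -> V *m V' = 1%:M ->
  (forall i j, ringO m (V i j)) -> (forall i j, ringO m (V' i j)) ->
  Gamma2 m (Wmx V).
Proof.
move=> detV VV' hV hV'; split; first exact: SU22_Wmx.
have Vu : adjmx V \in unitmx by rewrite unitmxE det_adjmx detV conjC1 unitr1.
have -> : Wmx V = block_mx V 0 0 (adjmx V').
  rewrite /Wmx; congr block_mx; rewrite -[RHS](mulmxK Vu) -adjmxM VV' adjmx1.
  by rewrite mul1mx.
by apply: ringO_block => // i j; rewrite !mxE; apply: ringOJ.
Qed.

(** * Coefficients of an invariant form *)

Section ReducedMatrices.
Variables (R : realType) (m : nat).
Hypothesis hm : squarefree m.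
Let w : Cplx R := sqrt_neg R m.

Lemma unipotent_stable (z : Cplx R) (T : 'M[Cplx R]_2) : ringO m z ->
  Lambda2 m T -> Lambda2 m (adjmx (mx2 1 z 0 1) *m T *m mx2 1 z 0 1).
Proof.
move=> hz [k [l [t ht ->]]].
have [tau htau] := dualO_trace hm hz ht; have [N hN] := ringO_norm hz.
have -> : adjmx (mx2 1 z 0 1) *m mx2 k%:~R t t^* l%:~R *m mx2 1 z 0 1 =
    mx2 k%:~R (k%:~R * z + t) (k%:~R * z + t)^* (l + tau + N * k)%:~R; last first.
  apply: Lambda2P; apply: dualOD => //; apply: dualO_ringO => //.
  by apply: ringOM => //; apply: ringO_int.
rewrite (rmorphD Num.conj) (rmorphM Num.conj) /= rmorph_int.
rewrite !(intrD, intrM) -htau -hN adjmx_mx2 rmorph1 rmorph0 !mul_mx2.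
by congr mx2; ring.
Qed.

Lemma disc_mul_norm_dualO (s : Cplx R) :
  let t := (if (m %% 4)%N == 3 then 1 else 2 : Cplx R) * w in
  - (disc m)%:~R * (t^-1 * s * (t^-1 * s)^*) = s * s^*.
Proof.
move=> t; have tE : t ^+ 2 = (disc m)%:~R := sqr_kappa_w R m.
have t0 : t != 0.
  by rewrite mulf_neq0 ?sqrt_neg_neq0 //; case: ifP; rewrite ?oner_eq0 ?pnatr_eq0.
have tJ : t^* = - t.
  rewrite rmorphM /= conj_sqrt_neg mulrN; congr (- (_ * _)).
  by case: ifP => _; rewrite ?rmorph1 ?rmorph_nat.
rewrite rmorphM fmorphV /= tJ -tE; field.
by rewrite t0.
Qed.

(** For off-diagonal entry s / sqrt(D) the value is -D k l minus the norm of s. Hence the truncation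
    in Krieg's relations loses nothing. *)
Lemma disc_det_nat (T : 'M[Cplx R]_2) : Lambda2 m T -> 0 <= \det T ->
  exists N : nat, - (disc m)%:~R * \det T = N%:R.
Proof.
move=> [k [l [t ht ->]]]; rewrite det_mx2 => det_ge0.
have [s hs tE] := (dualOP m t).1 ht.
have [N hN] := ringO_norm hs.
have disc_ge0 : 0 <= - (disc m)%:~R :> Cplx R.
  by rewrite -intrN ler0z /disc; case: ifP => _; rewrite opprK.
have dE : - (disc m)%:~R * (k%:~R * l%:~R - t * t^*) = (- disc m * (k * l) - N)%:~R.
  rewrite mulrBr tE disc_mul_norm_dualO hN intrB !intrM intrN; ring.
have := mulr_ge0 disc_ge0 det_ge0; rewrite dE ler0z.
by case: (_ - N) => // n _; exists n.
Qed.

(** Completing the square, the form is |x + t y|^2 + (l - |t|^2) |y|^2. *)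
Lemma possemidefmx_mx2 (t l : Cplx R) : 0 <= l - t * t^* ->
  possemidefmx (mx2 1 t t^* l).
Proof.
move=> h v; rewrite (mx2_eta (mx2 1 t t^* l)) !mx2E.
set x := v 0 0; set y := v 1 0.
have -> : (adjmx v *m mx2 1 t t^* l *m v) 0 0 =
    (x + t * y) * (x + t * y)^* + (l - t * t^*) * (y * y^*).
  rewrite !mxE big_ord_recl big_ord1.
  rewrite !mxE !big_ord_recl !big_ord0 !mxE /=.
  have -> : lift ord0 ord0 = 1 :> 'I_2 by apply: val_inj.
  rewrite -/x -/y (rmorphD Num.conj) (rmorphM Num.conj) /=; ring.
by rewrite addr_ge0 ?mul_conjC_ge0 // mulr_ge0 ?mul_conjC_ge0.
Qed.

(** The form takes the value k det at (-t, k), and l det at the vector with entries l and minus the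
    conjugate of t. If k = l = 0, its value -2 |t|^2 at (-t, 1) forces t = 0. *)
Lemma possemidefmx_det (k l : int) (t : Cplx R) :
  possemidefmx (mx2 k%:~R t t^* l%:~R) -> 0 <= k%:~R * l%:~R - t * t^*.
Proof.
move=> h.
have form x y : 0 <= (x^* * k%:~R + y^* * t^*) * x + (x^* * t + y^* * l%:~R) * y.
  pose v : 'cV[Cplx R]_2 := \col_i (if i == 0 then x else y).
  have := h v; rewrite !mxE big_ord_recl big_ord1 !mxE !big_ord_recl !big_ord0 !mxE /=.
  by rewrite !addr0.
set n := t * t^*; have n_ge0 : 0 <= n by apply: mul_conjC_ge0.
have k_ge0 : 0 <= k%:~R :> Cplx R.
  have := form 1 0; rewrite rmorph0 rmorph1; congr (0 <= _); ring.
have l_ge0 : 0 <= l%:~R :> Cplx R.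
  have := form 0 1; rewrite rmorph0 rmorph1; congr (0 <= _); ring.
move: k_ge0; rewrite le_eqVlt => /orP[/eqP k0|k_gt0]; last first.
  rewrite -(pmulr_rge0 _ k_gt0); have := form (- t) k%:~R.
  rewrite rmorphN rmorph_int; congr (0 <= _); rewrite /n /=; ring.
move: l_ge0; rewrite le_eqVlt => /orP[/eqP l0|l_gt0]; last first.
  rewrite -(pmulr_rge0 _ l_gt0); have := form l%:~R (- t^*).
  rewrite rmorphN rmorph_int /= conjCK; congr (0 <= _); rewrite /n /=; ring.
have := form (- t) 1.
rewrite -k0 -l0 rmorphN rmorph1 /= mul0r !mulr0 !mulr1 !mul1r add0r addr0.
by rewrite sub0r mulrN mulNr (mulrC t^*) -/n => h1; apply: le_trans h1 _; rewrite gerDl oppr_le0.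
Qed.

End ReducedMatrices.

Lemma same_parity_of_norm (m : nat) (x y k : int) : (m %% 4 = 3)%N ->
  x ^+ 2 + m%:Z * y ^+ 2 = 4 * k -> exists p, x - y = 2 * p.
Proof.
move=> m3; have [q ->] : exists q : int, m%:Z = 4 * q + 3 by exists (m %/ 4)%N; lia.
have [a ha] := even_or_odd x; have [b hb] := even_or_odd y.
case: ha => ->; case: hb => ->; rewrite !expr2 => hk.
- by exists (a - b); ring.
- by exfalso; lia.
- by exfalso; lia.
- by exists (a - b); ring.
Qed.

(** * Matching off-diagonal entries by some V_d *)

Section Transitivity.
Variables (R : realType) (m : nat).
Hypothesis hm : squarefree m.
Let w : Cplx R := sqrt_neg R m.

(* With t = u s, s = (x + y w) / 2 and u imaginary, V replaces s by
   s + H (x - m y) (1 - w) / 2 modulo the ring of integers. *)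
Lemma AtkinLehner_reduced (d : nat) (n e H x y l : int) (u t t' : Cplx R) :
  squarefree d -> (d %| `|disc m|)%N ->
  d%:Z ^+ 2 * e - n * (m * m.+1)%N%:Z = d%:Z -> d%:Z * H = (2 * m)%N%:Z * n ->
  dualO m t -> u^* = - u -> t = u * ((x%:~R + y%:~R * w) / 2) ->
  ringO m (t' - u * ((x%:~R + y%:~R * w + (H * (x - m%:Z * y))%:~R * (1 - w)) / 2)) ->
  exists d (V : 'M[Cplx R]_2) (z : Cplx R),
    [/\ squarefree d, (d %| `|disc m|)%N, AtkinLehner m d V, ringO m z &
      t' = (adjmx V *m mx2 1%:~R t t^* l%:~R *m V) 0 1 + z].
Proof.
move=> hd ddisc hdet hH ht uJ tE ring_diff.
have d_gt0 := squarefree_gt0 hd.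
have [p [q [hp hq]]] := squarefree_dvd_disc hm hd ddisc.
pose M : Cplx R := m%:R; pose D : Cplx R := d%:R.
have D0 : D != 0 by rewrite pnatr_eq0 -lt0n.
have dZ0 : d%:Z != 0 by case: (d) d_gt0.
pose om := M + w; pose om' := M - w.
have wE : w ^+ 2 = - M := sqr_sqrt_neg R m.
have om_ring : ringO m om.
  by apply: ringOD => //; [apply: (ringO_int _ _ m)|apply: ringO_sqrt_neg].
have de : d%:Z * e = 1 + n * p.
  apply: (mulfI dZ0); apply: eq_from_diff hdet _; rewrite -hp; ring.
have HE : H = n * q.
  by apply: (mulfI dZ0); rewrite hH -hq; ring.
have p2 : 2 * p = q * (m%:Z + 1).
  apply: (mulfI dZ0); rewrite mulrCA hp mulrA hq !PoszM -addn1 PoszD; ring.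
have deC : D * e%:~R = 1 + n%:~R * p%:~R.
  by have := congr1 (fun z : int => z%:~R : Cplx R) de; rewrite /= !(intrD, intrM) -pmulrn.
have p2C : 2 * p%:~R = q%:~R * (M + 1).
  by have := congr1 (fun z : int => z%:~R : Cplx R) p2; rewrite /= !(intrD, intrM) -!pmulrn.
(* With a = b = 1 and c = n, the determinant is (d^2 e - n m (m + 1)) / d = 1. *)
pose V := (sqrtC D)^-1 *:
  mx2 (1%:~R * D) (1%:~R * om) (n%:~R * om') (e%:~R * D).
have detV : \det V = 1.
  rewrite /V scale_mx2 det_mx2.
  have -> : (sqrtC D)^-1 * (1%:~R * D) * ((sqrtC D)^-1 * (e%:~R * D)) -
      (sqrtC D)^-1 * (1%:~R * om) * ((sqrtC D)^-1 * (n%:~R * om')) =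
      (sqrtC D)^-1 ^+ 2 * (D * (D * e%:~R) - n%:~R * (M ^+ 2 - w ^+ 2)).
    by rewrite /om /om'; ring.
  rewrite exprVn sqrtCK deC wE.
  have -> : M ^+ 2 - - M = D * p%:~R.
    have := congr1 (fun z : int => z%:~R : Cplx R) hp.
    rewrite /= intrM -!pmulrn natrM -addn1 natrD -/M -/D => ->; ring.
  by field.
have [tau htau] := dualO_trace hm om_ring ht.
rewrite (rmorphD Num.conj) (rmorph_nat Num.conj) /= conj_sqrt_neg in htau.
have VE := @AtkinLehner_conj _ _ _ _ _ d_gt0 hp hq 1 1 n e 1 l tau t V (erefl _) htau.
exists d, V, (t' - u * ((x%:~R + y%:~R * w + (H * (x - m%:Z * y))%:~R * (1 - w)) / 2)
  - (1 + n * e * l)%:~R * om); split => //.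
- by split => //; exists 1, 1, n, e.
- by apply: ringOD => //; apply: ringON; apply: ringOM => //; apply: ringO_int.
rewrite VE mx2_01 /AtkinLehner_offdiag -/w -/M -/D -/om.
have tJ : t^* = - u * ((x%:~R - y%:~R * w) / 2).
  rewrite tE (rmorphM Num.conj) /= uJ; congr (_ * _).
  rewrite (rmorphM Num.conj) /= fmorphV (rmorph_nat Num.conj).
  rewrite (rmorphD Num.conj) (rmorphM Num.conj) /= !rmorph_int conj_sqrt_neg.
  by rewrite mulrN.
(* Write s' for the conjugate of s. Dividing by u leaves s + n p (s - s') + n q (1 - w) s'. As p = q
   (1 - w) (1 + w) / 2 and s - s' = y w, the last two terms add up to n q (1 - w) (x + w^2 y) /
   2. *)
have step : 1%:~R * e%:~R * D * t + 1%:~R * n%:~R * (p%:~R - q%:~R * (1 - w)) * t^* =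
    u * ((x%:~R + y%:~R * w + (H * (x - m%:Z * y))%:~R * (1 - w)) / 2).
  have -> : 1%:~R * e%:~R * D * t = (D * e%:~R) * t by ring.
  have pE : p%:~R = q%:~R * (1 - w ^+ 2) / 2.
    by rewrite wE opprK (addrC 1) -p2C mulrC mulKf ?pnatr_eq0.
  rewrite deC tJ tE HE !(intrB, intrM) -!pmulrn -/M.
  have -> : M = - w ^+ 2 by rewrite wE opprK.
  by rewrite pE; field.
rewrite -step !(intrD, intrM); ring.
Qed.

Lemma ringO_half (x y : int) : (m %% 4 = 3)%N -> (2 %| x - y)%Z ->
  ringO m ((x%:~R + y%:~R * w) / 2).
Proof.
move=> m3 /dvdzP[k kE].
have -> : (x%:~R + y%:~R * w) / 2 = k%:~R + y%:~R * ((1 + w) / 2) :> Cplx R.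
  have -> : x = k * 2 + y by rewrite -kE; ring.
  by rewrite intrD intrM; field.
apply: ringOD; first exact: ringO_int.
apply: ringOM; first exact: ringO_int.
(* The polynomial is X^2 - X + (m + 1) / 4; for m = 3 mod 4 the constant is the floor of m / 4 plus
   1. *)
apply: (@ringO_monic_quadratic _ _ _ (-1) ((m %/ 4)%N%:Z + 1)).
  by exists 2^-1, 2^-1; rewrite fmorphV rmorph_nat -/w; field.
have wE : w ^+ 2 = - m%:R := sqr_sqrt_neg R m.
have mE : m%:R = 4 * (m %/ 4)%N%:R + 3 :> Cplx R.
  by rewrite {1}(divn_eq m 4) m3 natrD natrM mulrC.
rewrite intrD -pmulrn.
have -> : ((1 + w) / 2) ^+ 2 = (1 + 2 * w + w ^+ 2) / 4 by field.
by rewrite wE mE; field.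
Qed.

(** Only the off-diagonal entries are matched: once the upper left entry is 1 again, the determinant
    fixes the last entry. *)
Lemma AtkinLehner_transitive (t1 t2 : Cplx R) (l1 l2 : int) :
  dualO m t1 -> dualO m t2 -> l1%:~R - t1 * t1^* = l2%:~R - t2 * t2^* ->
  exists d (V : 'M[Cplx R]_2) (z : Cplx R),
    [/\ squarefree d, (d %| `|disc m|)%N, AtkinLehner m d V, ringO m z &
      t2 = (adjmx V *m mx2 1%:~R t1 t1^* l1%:~R *m V) 0 1 + z].
Proof.
move=> ht1 ht2 det_eq.
have [s1 hs1 t1E] := (dualOP m t1).1 ht1; have [s2 hs2 t2E] := (dualOP m t2).1 ht2.
have [x1 [y1 [k1 [s1E n1]]]] := ringO_half_int hm hs1.
have [x2 [y2 [k2 [s2E n2]]]] := ringO_half_int hm hs2.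
rewrite -/w in s1E s2E t1E t2E.
have wE : w ^+ 2 = - m%:R := sqr_sqrt_neg R m.
have w0 : w != 0 := sqrt_neg_neq0 R hm.
have norm_half (s : Cplx R) (x y k : int) : 2 * s = x%:~R + y%:~R * w ->
    x ^+ 2 + m%:Z * y ^+ 2 = 4 * k -> s * s^* = k%:~R.
  move=> sE nE.
  have sJ : 2 * s^* = x%:~R - y%:~R * w.
    have := congr1 Num.conj sE; rewrite (rmorphM Num.conj) (rmorph_nat Num.conj) => ->.
    by rewrite (rmorphD Num.conj) (rmorphM Num.conj) /= !rmorph_int conj_sqrt_neg mulrN.
  have n4 : (4 : Cplx R) != 0 by rewrite pnatr_eq0.
  apply: (mulfI n4).
  have -> : 4 * (s * s^*) = (2 * s) * (2 * s^*) by ring.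
  have := congr1 (fun z : int => z%:~R : Cplx R) nE.
  rewrite /= !expr2 intrD !intrM -!pmulrn => <-; rewrite sE sJ.
  have -> : m%:R = - w ^+ 2 by rewrite wE opprK.
  by ring.
have det_int : - disc m * (l1 - l2) = k1 - k2.
  apply: (@intr_inj (Cplx R)); rewrite intrM !intrB intrN.
  rewrite -(norm_half _ _ _ _ s1E n1) -(norm_half _ _ _ _ s2E n2).
  rewrite -(disc_mul_norm_dualO hm s1) -(disc_mul_norm_dualO hm s2) -/w -t1E -t2E -mulrBr.
  congr (_ * _); apply: eq_from_diff det_eq _; ring.
have kJ : (if (m %% 4)%N == 3 then 1 else 2 : Cplx R)^* =
    if (m %% 4)%N == 3 then 1 else 2.
  by case: ifP => _; rewrite ?rmorph1 ?rmorph_nat.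
set kappa := (if _ then 1 else 2) in t1E t2E kJ.
have uJ : ((kappa * w)^-1)^* = - (kappa * w)^-1.
  by rewrite fmorphV (rmorphM Num.conj) /= kJ conj_sqrt_neg mulrN invrN.
have half (s : Cplx R) (x y : int) : 2 * s = x%:~R + y%:~R * w ->
    s = (x%:~R + y%:~R * w) / 2.
  by move=> <-; rewrite mulrC mulKf ?pnatr_eq0.
rewrite (half _ _ _ s1E) in t1E; rewrite (half _ _ _ s2E) in t2E.
case: (eqVneq (m %% 4)%N 3) => m3.
  have discE : disc m = - m%:Z by rewrite /disc m3.
  have kE : kappa = 1 by rewrite /kappa m3.
  rewrite discE opprK in det_int.
  have mdv : (m %| x1 ^+ 2 - x2 ^+ 2)%Z.
    apply/dvdzP; exists (4 * (l1 - l2) - y1 ^+ 2 + y2 ^+ 2).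
    apply: eq_from_diff (congr2 (fun a b => a - b) n1 n2) _.
    by have := congr1 ( *%R 4) det_int => h; apply: eq_from_diff (esym h) _; ring.
  have [d [n [e [h [dm hdet hh /dvdzP[c cE]]]]]] := AtkinLehner_odd_disc hm mdv.
  apply: (AtkinLehner_reduced (H := 2 * h) _ _ _ hdet _ ht1 uJ t1E).
  - exact: squarefree_dvd hm dm.
  - by rewrite discE abszN absz_nat.
  - by rewrite mulrCA hh PoszM; ring.
  rewrite t2E -mulrBr kE mul1r.
  (* The two coordinates of the difference, doubled, are m X and Y. Division by w, with w^2 = -m,
     gives (Y - X w) / 2, which is integral because X and Y have equal parity. *)
  pose Y := y2 - y1 + 2 * h * (x1 - m%:Z * y1).
  pose X := - c + 2 * h * y1.
  have -> : w^-1 * ((x2%:~R + y2%:~R * w) / 2 -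
      (x1%:~R + y1%:~R * w + (2 * h * (x1 - m%:Z * y1))%:~R * (1 - w)) / 2) =
      (Y%:~R + (- X)%:~R * w) / 2.
    have xE : x2 - x1 - 2 * h * (x1 - m%:Z * y1) = m%:Z * X.
      by rewrite /X; apply: eq_from_diff (esym cE) _; ring.
    apply: (mulfI w0); rewrite mulVKf //.
    have -> : w * ((Y%:~R + (- X)%:~R * w) / 2) = (Y%:~R * w - X%:~R * w ^+ 2) / 2.
      by rewrite intrN; field.
    have xC := congr1 (fun z : int => z%:~R : Cplx R) xE.
    rewrite /= intrM -pmulrn in xC.
    by rewrite wE mulrN opprK (mulrC X%:~R) -xC /Y !(intrB, intrD); field.
  apply: ringO_half => //.
  have [p1 e1] := same_parity_of_norm m3 n1; have [p2 e2] := same_parity_of_norm m3 n2.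
  have [p3 e3] : exists p3 : int, m%:Z = 2 * p3 + 1.
    by exists (m %/ 2)%N; move: m3; clear; lia.
  apply/dvdzP; rewrite /Y /X.
  exists (p2 + y2 - p1 - y1 - h * m%:Z * y1 + h * y1 + p3 * c).
  have x1E : x1 = y1 + 2 * p1 by rewrite -e1; ring.
  have x2E : x2 = y2 + 2 * p2 by rewrite -e2; ring.
  rewrite e3 in cE.
  have cc : x1 + 2 * h * x1 - x2 - 2 * p3 * c = c by apply: eq_from_diff cE _; ring.
  rewrite x1E x2E in cc *; apply: eq_from_diff cc _; ring.
have discE : disc m = - (4 * m)%:Z by rewrite /disc (negbTE m3).
have kE : kappa = 2 by rewrite /kappa (negbTE m3).
have c4 : (4 * m)%:Z = 4 * m%:Z by clear; lia.
rewrite discE opprK in det_int.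
have m4 := squarefree_mod4 hm m3.
have [a1 [b1 [xa1 yb1]]] := even_of_norm m4 n1.
have [a2 [b2 [xa2 yb2]]] := even_of_norm m4 n2.
have hk : a1 ^+ 2 + m%:Z * b1 ^+ 2 - a2 ^+ 2 - m%:Z * b2 ^+ 2 = (4 * m)%:Z * (l1 - l2).
  have n4 : (4 : int) != 0 by [].
  apply: (mulfI n4); rewrite det_int; rewrite xa1 yb1 in n1; rewrite xa2 yb2 in n2.
  by apply: eq_from_diff (congr2 (fun a b => a - b) n1 n2) _; ring.
have [d [n [e [H [hd ddisc hdet hH [/dvdzP[X hX] /dvdzP[Y hY]]]]]]] :=
  AtkinLehner_even_disc hm m3 hk.
have ddisc' : (d %| `|disc m|)%N by rewrite discE abszN absz_nat.
apply: (@AtkinLehner_reduced d n e H x1 y1 l1 _ t1 t2 hd ddisc' hdet hH ht1 uJ t1E).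
rewrite t2E -mulrBr kE.
have -> : (2 * w)^-1 * ((x2%:~R + y2%:~R * w) / 2 -
    (x1%:~R + y1%:~R * w + (H * (x1 - m%:Z * y1))%:~R * (1 - w)) / 2) =
    (- Y)%:~R + X%:~R * w.
  have hXC := congr1 (fun z : int => z%:~R : Cplx R) hX.
  have hYC := congr1 (fun z : int => z%:~R : Cplx R) hY.
  rewrite /= !(intrD, intrM, intrB) -!pmulrn natrM in hXC hYC.
  have w20 : 2 * w != 0 by rewrite mulf_neq0 ?pnatr_eq0.
  apply: (mulfI w20); rewrite mulVKf //.
  have -> : 2 * w * ((- Y)%:~R + X%:~R * w) = - (Y%:~R * 2) * w - X%:~R * (2 * m%:R).
    have -> : m%:R = - w ^+ 2 by rewrite wE opprK.
    by rewrite intrN; ring.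
  rewrite -hXC -hYC xa1 yb1 xa2 yb2 !(intrD, intrM, intrB) -!pmulrn.
  by field.
apply: ringOD; first exact: ringO_int.
by apply: ringOM; [apply: ringO_int|apply: ringO_sqrt_neg].
Qed.

End Transitivity.

(** * From invariance to Krieg's function *)

Section ReducedCoefficients.
Variables (R : realType) (m : nat) (r : int) (f alpha : 'M[Cplx R]_2 -> Cplx R).
Hypothesis hm : squarefree m.
Hypothesis hfa : fourier_expansion m f alpha.
Hypothesis hmod : modular_form (@Gamma2 R m) r f.
Hypothesis hDelta : modular_form (@DeltaStar R m) r f.
Hypothesis hsug : forall T, Lambda2_ge0 m T -> T != 0 ->
  alpha T = \sum_(eta <- divisors (Defs.content m T))
    eta%:R ^ (r - 1) *
    alpha (mx2 1                  (T 0 1 / eta%:R)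
               (T 1 0 / eta%:R)   (T 1 1 * T 0 0 / eta%:R ^+ 2)).

Lemma content_reduced (T : 'M[Cplx R]_2) : Lambda2 m T -> T 0 0 = 1 ->
  Defs.content m T = 1%N.
Proof.
move=> LT T00.
have cand q : content_cand m T q -> q = 1%N.
  move=> [q0 [k [l [t _ hT]]]].
  have := congr1 (fun A : 'M[Cplx R]_2 => A 0 0) hT; rewrite mx2_00 mxE T00 mulr1 => hk.
  have qk : (q%:Z * k) = 1.
    apply: (@intr_inj (Cplx R)); rewrite intrM -hk -pmulrn mulfV //.
    by rewrite pnatr_eq0 -lt0n.
  have := congr1 absz qk; rewrite abszM absz_nat => /eqP.
  by rewrite muln_eq1 => /andP[/eqP].
have c1 : content_cand m T 1 by split => //; rewrite invr1 scale1r.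
rewrite /Defs.content; case: xgetP => [q _ [/cand]//|] h.
by exfalso; apply: (h 1%N); split => // q' /cand ->.
Qed.

Lemma reduced_Lambda2_ge0 (k l : int) (t : Cplx R) : dualO m t ->
  possemidefmx (mx2 k%:~R t t^* l%:~R) ->
  Lambda2_ge0 m (mx2 1 t t^* (l%:~R * k%:~R)).
Proof.
move=> ht hT; split; first by rewrite -intrM; apply: (Lambda2P 1).
by apply: possemidefmx_mx2; rewrite mulrC; apply: possemidefmx_det.
Qed.

Lemma reduced_coef_eq (t1 t2 : Cplx R) (l1 l2 : int) :
  Lambda2_ge0 m (mx2 1%:~R t1 t1^* l1%:~R) -> Lambda2_ge0 m (mx2 1%:~R t2 t2^* l2%:~R) ->
  dualO m t1 -> dualO m t2 ->
  \det (mx2 1%:~R t1 t1^* l1%:~R) = \det (mx2 1%:~R t2 t2^* l2%:~R) ->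
  alpha (mx2 1%:~R t1 t1^* l1%:~R) = alpha (mx2 1%:~R t2 t2^* l2%:~R).
Proof.
set T1 := mx2 _ t1 _ _; set T2 := mx2 _ t2 _ _ => hT1 hT2 ht1 ht2 det12.
have det12' : l1%:~R - t1 * t1^* = l2%:~R - t2 * t2^*.
  by move: det12; rewrite !det_mx2 !mul1r.
have [d [V [z [hd ddisc VAL hz t2E]]]] := AtkinLehner_transitive hm ht1 ht2 det12'.
rewrite -/T1 in t2E.
have [p [q [hp hq]]] := squarefree_dvd_disc hm hd ddisc.
have d0 := squarefree_gt0 hd.
have detV : \det V = 1 by case: VAL.
have [V' [V'AL VV' V'V]] := AtkinLehner_inv VAL.
have VL T := @AtkinLehner_stable _ _ hm _ _ _ d0 hp hq V T VAL.
have V'L T := @AtkinLehner_stable _ _ hm _ _ _ d0 hp hq V' T V'AL.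
have fV Z : halfspace Z -> f (V *m Z *m adjmx V) = f Z.
  apply: (modular_form_Wmx hDelta _ detV); exists d; split => //; split => //.
  exists 1%:M; first exact: Gamma2_1.
  by exists V => //; rewrite mul1mx.
have [LT1 pT1] := hT1.
rewrite -(fourier_coef_conj hfa detV VV' V'V VL V'L fV hT1).
set T := adjmx V *m T1 *m V in t2E *.
have LT : Lambda2 m T := VL _ LT1.
have pT : possemidefmx T := possemidefmx_conj V pT1.
have detT : \det T = \det T2.
  by rewrite -det12 /T !det_mulmx det_adjmx detV conjC1 mul1r mulr1.
have contT : Defs.content m T = 1%N.
  by rewrite (content_conj _ VV') // content_reduced // mx2_00.
have T0 : T != 0.
  apply/eqP => h; have := conj_cancel VV' T1; rewrite -/T h mulmx0 mul0mx.
  move/(congr1 (fun A : 'M[Cplx R]_2 => A 0 0)); rewrite mx2_00 mxE => /eqP.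
  by rewrite eq_sym oner_eq0.
(* The upper left entry k of T may differ from 1; the single term eta = 1 of Sugano's relation puts
   1 there and k l in the opposite corner. *)
rewrite (hsug (conj LT pT) T0) contT big_cons big_nil addr0 exp1rz mul1r expr1n !divr1.
have [k [l [t ht TE]]] := LT.
rewrite TE !mx2E; rewrite TE in pT detT; rewrite TE mx2_01 in t2E.
have hT' := reduced_Lambda2_ge0 ht pT.
(* Conjugation by U keeps the entry 1 and adds z to the off-diagonal entry, which becomes t2. *)
pose U : 'M[Cplx R]_2 := mx2 1 z 0 1; pose U' : 'M[Cplx R]_2 := mx2 1 (- z) 0 1.
have detU : \det U = 1 by rewrite det_mx2; ring.
have UU' : U *m U' = 1%:M by rewrite mul_mx2 one_mx2; congr mx2; ring.
have U'U : U' *m U = 1%:M by apply: mulmx1C.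
have UL T3 := @unipotent_stable R m hm z T3 hz.
have U'L T3 := @unipotent_stable R m hm (- z) T3 (ringON hz).
have U_ring (y : Cplx R) : ringO m y -> forall i j, ringO m (mx2 1 y 0 1 i j).
  move=> hy i j; rewrite mxE; have h1 : ringO m (1 : Cplx R) by apply: (ringO_int _ _ 1).
  have h0 : ringO m (0 : Cplx R) by apply: (ringO_int _ _ 0).
  by case: (i == 0); case: (j == 0).
have fU Z : halfspace Z -> f (U *m Z *m adjmx U) = f Z.
  apply: (modular_form_Wmx hmod _ detU); apply: (Gamma2_Wmx detU UU'); apply: U_ring => //.
  exact: ringON.
rewrite -(fourier_coef_conj hfa detU UU' U'U UL U'L fU hT').
congr alpha.
have detT' : \det (mx2 1 t t^* (l%:~R * k%:~R)) = \det T2.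
  by rewrite -detT !det_mx2 mul1r mulrC.
have : \det (adjmx U *m mx2 1 t t^* (l%:~R * k%:~R) *m U) = \det T2.
  by rewrite !det_mulmx det_adjmx detU conjC1 mul1r mulr1.
rewrite /T2 adjmx_mx2 rmorph1 rmorph0 !mul_mx2 !det_mx2 t2E !(rmorphD Num.conj) /= => hdet.
congr mx2; [by ring|by ring|by ring|].
apply: eq_from_diff hdet _; ring.
Qed.

Lemma DeltaStar_krieg_space : krieg_space m r f.
Proof.
split=> //; exists alpha => //.
(* Krieg's function at n is [alpha] at a chosen matrix with upper left entry 1 and -D det = n. The
   default 0 of [xget] is never reached where the relations evaluate it. *)
pose red n : set 'M[Cplx R]_2 := [set T | [/\ Lambda2_ge0 m T, T 0 0 = 1 &
  Num.truncn (complex.Re (- (disc m)%:~R * \det T)) = n]].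
exists (fun n => alpha (xget 0 (red n))) => T LT T0.
rewrite hsug //; apply: eq_big_seq => eta eta_dvd; congr (_ * _).
have [eta_gt0 [k [l [t ht TE]]]] : (0 < eta)%N /\ Lambda2 m (eta%:R^-1 *: T).
  (* In the junk case of content 0 the list divisors 0 is [:: 1]. *)
  case: (posnP (Defs.content m T)) eta_dvd => [->|c_gt0].
    by rewrite inE => /eqP ->; split=> //; rewrite invr1 scale1r; case: LT.
  rewrite -dvdn_divisors // => eta_c; split; first exact: dvdn_gt0 eta_c.
  have : Lambda2 m ((Defs.content m T)%:R^-1 *: T).
    move: c_gt0; rewrite /Defs.content; case: xgetP => // q _ [[_ hq] _] _.
    exact: hq.
  (* The content is c' eta, so T / eta is c' times a lattice element. *)
  move: c_gt0; have [c' ->] := dvdnP eta_c; rewrite muln_gt0 => /andP[c'0 _].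
  have c'N : c'%:R != 0 :> Cplx R by rewrite pnatr_eq0 -lt0n.
  move=> [k [l [t ht TE]]]; exists (c'%:Z * k), (c'%:Z * l), (c'%:R * t).
    by apply: dualOM => //; apply: (ringO_int _ _ c').
  have -> : eta%:R^-1 *: T = c'%:R *: ((c' * eta)%:R^-1 *: T).
    by rewrite scalerA natrM invfM mulrA divff // mul1r.
  by rewrite TE scale_mx2 !intrM -!pmulrn (rmorphM Num.conj) /= rmorph_nat.
have eta0 : eta%:R != 0 :> Cplx R by rewrite pnatr_eq0 -lt0n.
have pT : possemidefmx (mx2 k%:~R t t^* l%:~R).
  move=> v; rewrite -TE -scalemxAr -scalemxAl mxE mulr_ge0 ?invr_ge0 ?ler0n //.
  exact: LT.2.
have redE : mx2 1 (T 0 1 / eta%:R) (T 1 0 / eta%:R) (T 1 1 * T 0 0 / eta%:R ^+ 2) =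
    mx2 1%:~R t t^* (l * k)%:~R.
  have ent i j : T i j / eta%:R = (mx2 k%:~R t t^* l%:~R) i j by rewrite -TE mxE mulrC.
  rewrite !ent !mx2E intrM; congr mx2.
  by have := ent 0 0; have := ent 1 1; rewrite !mx2E => <- <-; field.
have detE : \det T / eta%:R ^+ 2 = \det (mx2 1%:~R t t^* (l * k)%:~R).
  rewrite det_mx2 intrM mul1r mulrC -exprVn -detZ TE det_mx2; ring.
rewrite redE -mulrA detE; set n := Num.truncn _.
have hT' : Lambda2_ge0 m (mx2 1%:~R t t^* (l * k)%:~R).
  by rewrite intrM; apply: reduced_Lambda2_ge0.
have inred : red n (mx2 1%:~R t t^* (l * k)%:~R) by split=> //; rewrite mx2_00.
case: xgetP => [T' _ [hT2 T'00 T'n]|h]; last by case: (h _ inred).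
have [[k2 [l2 [t2 ht2 T'E]]] _] := hT2.
have k2E : k2 = 1.
  by apply: (@intr_inj (Cplx R)); move: T'00; rewrite T'E mx2_00.
have det_ge0 (t3 : Cplx R) (l3 : int) : possemidefmx (mx2 1%:~R t3 t3^* l3%:~R) ->
    0 <= \det (mx2 1%:~R t3 t3^* l3%:~R).
  by move=> h; rewrite det_mx2; apply: possemidefmx_det.
rewrite T'E k2E in hT2 T'n *.
apply: reduced_coef_eq => //.
(* Both values of -D det are natural numbers, so equal truncations give equal determinants. *)
have [N1 hN1] := disc_det_nat hm hT'.1 (det_ge0 _ _ hT'.2).
have [N2 hN2] := disc_det_nat hm hT2.1 (det_ge0 _ _ hT2.2).
have Re_nat (N : nat) : Num.truncn (complex.Re (N%:R : Cplx R)) = N.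
  have -> : N%:R = Complex N%:R 0 :> Cplx R.
    by rewrite -[RHS]/(real_complex R N%:R) rmorph_nat.
  exact: natrK.
have disc0 : - (disc m)%:~R != 0 :> Cplx R.
  rewrite oppr_eq0 intr_eq0 /disc; have := squarefree_gt0 hm.
  by case: ifP => _; rewrite oppr_eq0 -lt0n // muln_gt0.
apply: (mulfI disc0); rewrite hN1 hN2; congr (_%:R).
by move: T'n; rewrite /n hN1 hN2 !Re_nat.
Qed.

End ReducedCoefficients.

Theorem theorem3 (R : realType) (m : nat) (hm : squarefree m) (r : int)
    (f : 'M[Cplx R]_2 -> Cplx R) (hf : @sugano_space R m r f) :
  @krieg_space R m r f <-> modular_form (@DeltaStar R m) r f.
Proof.
split; first exact: krieg_space_DeltaStar.
have [hmod [alpha hfa hsug]] := hf.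
by move=> hDelta; apply: (DeltaStar_krieg_space hm hfa hmod hDelta hsug).
Qed.
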